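(* Let $G$ be a finite group acting (by group automorphisms, not necessarily faithfully) on a finitely presentable group $M$. Then there is a topological space $X$ such that: (i) $\mathcal{E}(X)\cong G$; (ii) $\pi_1(X)\cong M$; (iii) the action $G\curvearrowright M$ is equivalent to the canonical action $\mathcal{E}(X)\curvearrowright \pi_1(X)$.
   Context: Spaces are pointed. $\mathcal{E}(X)$ denotes the group of self-homotopy equivalences of $X$, i.e. the group (under composition) of homotopy classes of (pointed) maps $X\to X$ that are homotopy equivalences. The canonical action of $\mathcal{E}(X)$ on $\pi_1(X)$ is $[f]\cdot\alpha=f_*(\alpha)$, where $f_*$ is the induced homomorphism. An action of $G$ on a group $M$ is equivalent to an action of a group $G'$ on a group $M'$ if there are group isomorphisms $\varphi\colon G\to G'$ and $\psi\colon M\to M'$ with $\psi(g\cdot m)=\varphi(g)\cdot\psi(m)$ for all $g\in G$, $m\in M$. *)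

(* Defs.v *)
From HB Require Import structures.
From mathcomp Require Import all_boot all_order all_algebra fingroup.
From mathcomp Require Import generic_quotient.
From mathcomp Require Import all_classical reals topology normedtype.
From mathcomp Require Import homotopy.
From mathcomp Require Import ring lra.

Set Implicit Arguments.
Unset Strict Implicit.
Unset Printing Implicit Defensive.

Import Order.TTheory GRing.Theory Num.Theory.
Import numFieldNormedType.Exports.

Local Open Scope classical_set_scope.
Local Open Scope ring_scope.
Local Open Scope quotient_scope.

Definition unit_interval (R : realType) : Type := set_type [set` `[0 : R, 1]].

HB.instance Definition _ (R : realType) :=
  Topological.copy (unit_interval R) (set_type [set` `[0 : R, 1]]).

Section Interval.
Context {R : realType}.
Local Notation I := (unit_interval R).
Implicit Types (s t : I) (x : R).

Definition ival t : R := set_val t.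

Lemma ival_itv t : 0 <= ival t <= 1.
Proof. by case: t => x xP; move: (set_mem xP); rewrite /= in_itv. Qed.

Lemma ival_inj : injective ival.
Proof. exact: val_inj. Qed.

Lemma ival_cts : continuous ival.
Proof. exact: initial_continuous. Qed.

Lemma clamp_subproof x : Num.max 0 (Num.min 1 x) \in [set` `[0 : R, 1]].
Proof.
by rewrite inE /= in_itv /= le_max lexx /= ge_max ler01 /= ge_min lexx.
Qed.

Definition clamp x : I := @exist R _ _ (clamp_subproof x).

Lemma clampE x : ival (clamp x) = Num.max 0 (Num.min 1 x).
Proof. by []. Qed.

Lemma clamp_cts : continuous clamp.
Proof.
apply: (@continuous_comp_initial I R R ival clamp) => x.
apply: (@continuous_max R R (cst 0) (fun x => Num.min 1 x)).
  exact: cst_continuous.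
apply: (@continuous_min R R (cst 1) id); first exact: cst_continuous.
exact: cvg_id.
Qed.

Lemma clamp_id x : 0 <= x <= 1 -> ival (clamp x) = x.
Proof.
by move=> /andP[x0 x1]; rewrite clampE min_r// max_r.
Qed.

Let i0 : I := clamp 0.
Let i1 : I := clamp 1.

Let i01_neq : i0 != i1.
Proof. by apply/eqP => /(congr1 ival); rewrite !clamp_id ?lexx ?ler01//; lra. Qed.

HB.instance Definition _ := isBiPointed.Build I i01_neq.

Lemma ival0 : ival zero = 0.
Proof. by rewrite clamp_id// lexx ler01. Qed.

Lemma ival1 : ival one = 1.
Proof. by rewrite clamp_id// lexx ler01. Qed.

End Interval.

Lemma paste_cts {R : realType} {T Z : topologicalType} (a : T -> R) (b : R)
    (F G : T -> Z) :
  continuous a -> continuous F -> continuous G ->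
  (forall x, a x = b -> F x = G x) ->
  continuous (fun x => if a x <= b then F x else G x).
Proof.
move=> ca cF cG FG; pose h x := if a x <= b then F x else G x.
pose A := a @^-1` [set x | x <= b]; pose B := a @^-1` [set x | b <= x].
have AB : A `|` B = setT.
  by apply/seteqP; split=> // x _; case: (leP (a x) b) => [|/ltW]; [left|right].
have cA : closed A by move/continuous_closedP: ca; apply; exact: closed_le.
have cB : closed B by move/continuous_closedP: ca; apply; exact: closed_ge.
apply/continuous_subspace_setT; rewrite -AB; apply: withinU_continuous => //.
- have e : {in A, F =1 h} by move=> x; rewrite inE /A /h /= => ->.
  exact/(subspace_eq_continuous e)/continuous_subspaceT.
- have e : {in B, G =1 h}.
    move=> x; rewrite inE /B /h /= => bx; case: (leP (a x) b) => // xb.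
    by rewrite FG//; apply/le_anti; rewrite xb.
  exact/(subspace_eq_continuous e)/continuous_subspaceT.
Qed.

Lemma continuous_pair {T U V : topologicalType} (f : T -> U) (g : T -> V) :
  continuous f -> continuous g -> continuous (fun x => (f x, g x)).
Proof. by move=> cf cg x; apply: cvg_pair; [exact: cf|exact: cg]. Qed.

Lemma continuous_compT {T U V : topologicalType} (f : T -> U) (g : U -> V) :
  continuous f -> continuous g -> continuous (fun x => g (f x)).
Proof. by move=> cf cg x; apply: continuous_comp; [exact: cf|exact: cg]. Qed.

Lemma continuous_fst {T U : topologicalType} : continuous (@fst T U).
Proof. by move=> x; exact: cvg_fst. Qed.

Lemma continuous_snd {T U : topologicalType} : continuous (@snd T U).
Proof. by move=> x; exact: cvg_snd. Qed.

Lemma continuousDr {R : realType} {T : topologicalType} (f g : T -> R) :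
  continuous f -> continuous g -> continuous (fun x => f x + g x).
Proof. by move=> cf cg x; apply: (@cvgD R R^o); [exact: cf|exact: cg]. Qed.

Lemma continuousMr {R : realType} {T : topologicalType} (f g : T -> R) :
  continuous f -> continuous g -> continuous (fun x => f x * g x).
Proof. by move=> cf cg x; apply: cvgM; [exact: cf|exact: cg]. Qed.

Section Homotopy.
Variable R : realType.
Local Notation I := (unit_interval R).

(* Homotopy relative to [A]; with [A] the base point this is pointed homotopy,
   with [A] the endpoints of [I] it is path homotopy. *)
Definition homotopic_rel (Y X : topologicalType) (A : set Y) (f g : Y -> X) :=
  exists H : I * Y -> X,
    [/\ continuous H, forall y, H (zero, y) = f y, forall y, H (one, y) = g y
      & forall t y, A y -> H (t, y) = f y].

Section Equivalence.
Context {Y X : topologicalType} (A : set Y).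
Implicit Types f g h : Y -> X.

Lemma homotopic_refl f : continuous f -> homotopic_rel A f f.
Proof.
move=> cf; exists (f \o snd); split=> //.
exact: continuous_compT continuous_snd cf.
Qed.

Lemma affine_cts (a b : R) : continuous (fun t : I => clamp (a * ival t + b)).
Proof.
apply: continuous_compT clamp_cts; apply: continuousDr; last exact: cst_continuous.
by apply: continuousMr; [exact: cst_continuous|exact: ival_cts].
Qed.

Lemma clampK (t : I) : clamp (ival t) = t.
Proof. by apply: ival_inj; rewrite clamp_id// ival_itv. Qed.

Lemma clamp0 : clamp 0 = zero :> I. Proof. by []. Qed.
Lemma clamp1 : clamp 1 = one :> I. Proof. by []. Qed.

Lemma clamp_le0 (x : R) : x <= 0 -> clamp x = zero :> I.
Proof.
move=> x0; apply: (ival_inj (_ : ival (clamp x) = ival (clamp 0))).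
by rewrite !clampE !min_r ?max_l ?lexx//; lra.
Qed.

Lemma clamp_ge1 (x : R) : 1 <= x -> clamp x = one :> I.
Proof.
move=> x1; apply: (ival_inj (_ : ival (clamp x) = ival (clamp 1))).
by rewrite !clampE !min_l ?lexx.
Qed.

Lemma homotopic_sym f g : homotopic_rel A f g -> homotopic_rel A g f.
Proof.
move=> [H [cH H0 H1 HA]].
exists (fun p => H (clamp (-1 * ival p.1 + 1), p.2)); split=> /=.
- apply: continuous_compT cH; apply: continuous_pair continuous_snd.
  exact: continuous_compT continuous_fst (@affine_cts _ _).
- by move=> y; rewrite ival0 mulr0 add0r clamp1.
- by move=> y; rewrite ival1 mulr1 addNr clamp0.
- by move=> t y Ay; rewrite -H1 !HA.
Qed.

Lemma homotopic_trans f g h :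
  homotopic_rel A f g -> homotopic_rel A g h -> homotopic_rel A f h.
Proof.
move=> [H [cH H0 H1 HA]] [K [cK K0 K1 KA]].
exists (fun p => if ival p.1 <= 1 / 2 then H (clamp (2 * ival p.1 + 0), p.2)
                 else K (clamp (2 * ival p.1 + -1), p.2)); split=> /=.
- apply: paste_cts.
  + exact: continuous_compT continuous_fst ival_cts.
  + apply: continuous_compT cH; apply: continuous_pair continuous_snd.
    exact: continuous_compT continuous_fst (@affine_cts _ _).
  + apply: continuous_compT cK; apply: continuous_pair continuous_snd.
    exact: continuous_compT continuous_fst (@affine_cts _ _).
  + move=> [t y] /= ->.
    rewrite (_ : 2 * (1 / 2) + 0 = 1); last by lra.
    rewrite (_ : 2 * (1 / 2) + -1 = 0); last by lra.
    by rewrite clamp0 clamp1 H1 K0.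
- move=> y; rewrite ival0 ifT; last by lra.
  by rewrite mulr0 addr0 clamp0.
- move=> y; rewrite ival1 ifF; last by apply/negbTE; rewrite -ltNge; lra.
  rewrite (_ : 2 * 1 + -1 = 1); last by lra.
  by rewrite clamp1.
- by move=> t y Ay; case: ifP => _; rewrite ?HA// KA// -K0 KA// -H1 HA.
Qed.

End Equivalence.

Lemma homotopic_comp (Z Y X : topologicalType) (A : set Z) (B : set Y)
    (f f' : Z -> Y) (g g' : Y -> X) :
  (forall z, A z -> B (f z)) ->
  homotopic_rel A f f' -> homotopic_rel B g g' ->
  homotopic_rel A (g \o f) (g' \o f').
Proof.
move=> AB [H [cH H0 H1 HA]] [K [cK K0 K1 KA]].
exists (fun p => K (p.1, H p)); split=> /=.
- exact: continuous_compT (continuous_pair continuous_fst cH) cK.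
- by move=> y; rewrite H0 K0.
- by move=> y; rewrite H1 K1.
- by move=> t y Ay; rewrite HA// KA//; exact: AB.
Qed.

Lemma homotopic_reparam (X : topologicalType) (f : I -> X) (p q : I -> I) :
  continuous f -> continuous p -> continuous q ->
  p zero = q zero -> p one = q one ->
  homotopic_rel [set zero; one] (f \o p) (f \o q).
Proof.
move=> cf cp cq pq0 pq1.
exists (fun u => f (clamp (ival (p u.2) +
                           ival u.1 * (ival (q u.2) - ival (p u.2))))).
split=> /=.
- apply: continuous_compT cf; apply: continuous_compT clamp_cts.
  have c1 : continuous (fun u : I * I => ival u.1).
    exact: continuous_compT continuous_fst ival_cts.
  have cP : continuous (fun u : I * I => ival (p u.2)).
    apply: continuous_compT ival_cts.
    exact: continuous_compT continuous_snd cp.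
  have cQ : continuous (fun u : I * I => ival (q u.2)).
    apply: continuous_compT ival_cts.
    exact: continuous_compT continuous_snd cq.
  apply: (continuousDr cP); apply: (continuousMr c1).
  apply: (continuousDr cQ); apply: (continuous_compT cP).
  exact: opp_continuous.
- by move=> y; rewrite ival0 mul0r addr0 clampK.
- by move=> y; rewrite ival1 mul1r addrC subrK clampK.
- by move=> t y [] /= ->; rewrite -?pq0 -?pq1 subrr mulr0 addr0 clampK.
Qed.

End Homotopy.

Section FundamentalGroup.
Variables (R : realType) (X : ptopologicalType).
Local Notation I := (unit_interval R).

Definition loop := {path I from (point : X) to (point : X)}.

HB.instance Definition _ := Choice.on loop.

Implicit Types f g h : loop.

Definition loop_homotopic : rel loop :=
  fun f g => `[< homotopic_rel R [set zero; one] f g >].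

Let loop_cts f : continuous f. Proof. exact: cts_fun. Qed.

Lemma loop_homotopic_refl : reflexive loop_homotopic.
Proof. by move=> f; apply/asboolP; exact: homotopic_refl. Qed.

Lemma loop_homotopic_sym : symmetric loop_homotopic.
Proof. by move=> f g; apply/asboolP/asboolP; exact: homotopic_sym. Qed.

Lemma loop_homotopic_trans : transitive loop_homotopic.
Proof.
by move=> g f h /asboolP fg /asboolP gh; apply/asboolP/(homotopic_trans fg).
Qed.

Canonical loop_equiv := EquivRel loop_homotopic loop_homotopic_refl
  loop_homotopic_sym loop_homotopic_trans.

Definition pi1 := {eq_quot loop_equiv}.

HB.instance Definition _ := Choice.on pi1.
HB.instance Definition _ := EqQuotient.on pi1.

Lemma pi1P f g :
  \pi_pi1 f = \pi_pi1 g <-> homotopic_rel R [set zero; one] f g.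
Proof.
split=> [/eqmodP/asboolP//|fg]; first by apply/eqmodP/asboolP.
Qed.

(* [clamp] is the identity on the arguments actually used, [2 t] for
   [t <= 1/2] and [2 t - 1] for [t >= 1/2]. *)
Definition loop_cat_fun f g (t : I) : X :=
  if ival t <= 1 / 2 then f (clamp (2 * ival t + 0))
  else g (clamp (2 * ival t + -1)).

Lemma loop_cat_le f g t :
  ival t <= 1 / 2 -> loop_cat_fun f g t = f (clamp (2 * ival t + 0)).
Proof. by rewrite /loop_cat_fun => ->. Qed.

Lemma loop_cat_ge f g t :
  1 / 2 <= ival t -> loop_cat_fun f g t = g (clamp (2 * ival t + -1)).
Proof.
move=> ht; rewrite /loop_cat_fun; case: (leP (ival t) (1 / 2)) => // th.
have -> : ival t = 1 / 2 by apply/le_anti; rewrite th.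
rewrite (_ : 2 * (1 / 2) + 0 = 1); last by lra.
rewrite (_ : 2 * (1 / 2) + -1 = 0); last by lra.
by rewrite clamp0 clamp1 path_zero path_one.
Qed.

Lemma loop_cat_cts f g : continuous (loop_cat_fun f g).
Proof.
apply: paste_cts; first exact: ival_cts.
- apply: (@continuous_compT I I X _ f); [exact: affine_cts|exact: loop_cts].
- apply: (@continuous_compT I I X _ g); [exact: affine_cts|exact: loop_cts].
- move=> t th; rewrite -(loop_cat_le f g) ?th//.
  by rewrite loop_cat_ge ?th.
Qed.

Lemma loop_cat_zero f g : loop_cat_fun f g zero = point.
Proof.
rewrite loop_cat_le ival0 ?mulr0 ?add0r ?clamp0 ?path_zero//; lra.
Qed.

Lemma loop_cat_one f g : loop_cat_fun f g one = point.
Proof.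
rewrite loop_cat_ge ival1; last by lra.
rewrite (_ : 2 * 1 + -1 = 1); last by lra.
by rewrite clamp1 path_one.
Qed.

Definition loop_cat f g : loop :=
  mk_path (@loop_cat_cts f g) (loop_cat_zero f g) (loop_cat_one f g).

Lemma loop_catl f g t :
  ival t <= 1 / 2 -> loop_cat f g t = f (clamp (2 * ival t + 0)).
Proof. exact: loop_cat_le. Qed.

Lemma loop_catr f g t :
  1 / 2 <= ival t -> loop_cat f g t = g (clamp (2 * ival t + -1)).
Proof. exact: loop_cat_ge. Qed.

Definition loop_rev_fun f (t : I) : X := f (clamp (-1 * ival t + 1)).

Lemma loop_rev_cts f : continuous (loop_rev_fun f).
Proof. apply: (@continuous_compT I I X _ f); [exact: affine_cts|exact: loop_cts]. Qed.

Lemma loop_rev_zero f : loop_rev_fun f zero = point.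
Proof. by rewrite /loop_rev_fun ival0 mulr0 add0r clamp1 path_one. Qed.

Lemma loop_rev_one f : loop_rev_fun f one = point.
Proof. by rewrite /loop_rev_fun ival1 mulr1 addNr clamp0 path_zero. Qed.

Definition loop_rev f : loop :=
  mk_path (@loop_rev_cts f) (loop_rev_zero f) (loop_rev_one f).

Definition loop_cst : loop := cst (point : X).

Lemma loop_cat_homotopic f f' g g' :
  homotopic_rel R [set zero; one] f f' ->
  homotopic_rel R [set zero; one] g g' ->
  homotopic_rel R [set zero; one] (loop_cat f g) (loop_cat f' g').
Proof.
move=> [H [cH H0 H1 HA]] [K [cK K0 K1 KA]].
have Hz s : H (s, zero) = point by rewrite HA ?path_zero//; left.
have Ho s : H (s, one) = point by rewrite HA ?path_one//; right.
have Kz s : K (s, zero) = point by rewrite KA ?path_zero//; left.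
have Ko s : K (s, one) = point by rewrite KA ?path_one//; right.
exists (fun p => if ival p.2 <= 1 / 2 then H (p.1, clamp (2 * ival p.2 + 0))
                 else K (p.1, clamp (2 * ival p.2 + -1))); split=> /=.
- apply: paste_cts.
  + exact: continuous_compT continuous_snd ival_cts.
  + apply: (@continuous_compT _ _ _ _ H) => //.
    apply: (continuous_pair continuous_fst).
    exact: continuous_compT continuous_snd (@affine_cts R _ _).
  + apply: (@continuous_compT _ _ _ _ K) => //.
    apply: (continuous_pair continuous_fst).
    exact: continuous_compT continuous_snd (@affine_cts R _ _).
  + move=> [s t] /= ->.
    rewrite (_ : 2 * (1 / 2) + 0 = 1); last by lra.
    rewrite (_ : 2 * (1 / 2) + -1 = 0); last by lra.
    by rewrite clamp0 clamp1 Ho Kz.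
- by move=> t; rewrite H0 K0.
- by move=> t; rewrite H1 K1.
- move=> s t [] /= ->; rewrite ?path_zero ?path_one ?ival0 ?ival1.
    rewrite ifT; last by lra.
    by rewrite mulr0 addr0 clamp0.
  rewrite ifF; last by apply/negbTE; rewrite -ltNge; lra.
  by rewrite (_ : 2 * 1 + -1 = 1) ?clamp1//; lra.
Qed.

Lemma loop_rev_homotopic f f' :
  homotopic_rel R [set zero; one] f f' ->
  homotopic_rel R [set zero; one] (loop_rev f) (loop_rev f').
Proof.
move=> ff'; have := @homotopic_comp R I I X [set zero; one] [set zero; one]
  (fun t => clamp (-1 * ival t + 1)) _ f f' _ _ ff'.
apply; last by apply: homotopic_refl; exact: affine_cts.
move=> t [] /= ->; [right|left] => /=.
  by rewrite ival0 mulr0 add0r.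
by rewrite ival1 mulr1 addNr.
Qed.

Lemma loop_reparam f (p q : I -> I) (h : I -> X) :
  continuous p -> continuous q -> p zero = q zero -> p one = q one ->
  h =1 f \o p -> homotopic_rel R [set zero; one] h (f \o q).
Proof.
by move=> cp cq e0 e1 /funext ->; apply: homotopic_reparam => //; exact: cts_fun.
Qed.

Let minR_cts (a b : I -> R) : continuous a -> continuous b ->
  continuous (fun t => Num.min (a t) (b t)).
Proof.
move=> ca cb t; apply: (@continuous_min R I a b t); [exact: ca|exact: cb].
Qed.

Let aff_cts (a b : R) : continuous (fun t : I => a * ival t + b).
Proof.
apply: continuousDr; last exact: cst_continuous.
by apply: continuousMr; [exact: cst_continuous|exact: ival_cts].
Qed.

Let id_cts : continuous (@id I).
Proof. by move=> x; exact: cvg_id. Qed.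

Lemma loop_catA f g h :
  homotopic_rel R [set zero; one] (loop_cat (loop_cat f g) h)
                                  (loop_cat f (loop_cat g h)).
Proof.
pose m t : R := Num.min (2 * ival t + 0)
                        (Num.min (1 * ival t + 1 / 4) (1 / 2 * ival t + 1 / 2)).
apply: (@loop_reparam _ (fun t => clamp (m t)) id) => //.
- apply: (@continuous_compT _ _ _ _ clamp); last exact: clamp_cts.
  apply: minR_cts; first exact: aff_cts.
  by apply: minR_cts; exact: aff_cts.
- by rewrite /m ival0 min_l ?mulr0 ?addr0// le_min; lra.
- rewrite /m ival1 [X in Num.min _ X]min_r; last by lra.
  rewrite min_r; last by lra.
  by rewrite (_ : _ + _ = 1) ?clamp1//; lra.
move=> t; have := ival_itv t; move et : (ival t) => x => x01 /=.
have [t4|t4] := leP x (1 / 4).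
  have -> : m t = 2 * x by rewrite /m et min_l ?addr0// le_min; lra.
  rewrite loop_catl et ?addr0; last by lra.
  rewrite loop_catl clamp_id; [|lra..].
  by rewrite loop_catl clamp_id; [|lra..].
have [t2|t2] := leP x (1 / 2).
  have -> : m t = x + 1 / 4.
    rewrite /m et [X in Num.min _ X]min_l; last by lra.
    by rewrite min_r; lra.
  rewrite loop_catl et ?addr0; last by lra.
  rewrite loop_catr clamp_id; [|lra..].
  rewrite loop_catr clamp_id; [|lra..].
  rewrite loop_catl clamp_id; [|lra..].
  by congr (g (clamp _)); lra.
have -> : m t = 1 / 2 * x + 1 / 2.
  rewrite /m et [X in Num.min _ X]min_r; last by lra.
  by rewrite min_r; lra.
rewrite loop_catr et; last by lra.
rewrite loop_catr clamp_id; [|lra..].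
rewrite loop_catr clamp_id; [|lra..].
by congr (h (clamp _)); lra.
Qed.

Lemma loop_cat1l f :
  homotopic_rel R [set zero; one] (loop_cat loop_cst f) f.
Proof.
apply: (@loop_reparam _ (fun t => clamp (2 * ival t + -1)) id) => //.
- exact: affine_cts.
- by rewrite clamp_le0// ival0; lra.
- by rewrite ival1 (_ : _ + _ = 1) ?clamp1//; lra.
move=> t /=.
have [t2|/ltW t2] := leP (ival t) (1 / 2); last by rewrite loop_catr.
rewrite loop_catl// [in RHS]clamp_le0 ?path_zero//; lra.
Qed.

Lemma loop_cat1r f :
  homotopic_rel R [set zero; one] (loop_cat f loop_cst) f.
Proof.
have cl t : 1 / 2 <= ival t -> clamp (2 * ival t + 0) = one :> I.
  by move=> t2; rewrite clamp_ge1//; lra.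
apply: (@loop_reparam _ (fun t => clamp (2 * ival t + 0)) id) => //.
- exact: affine_cts.
- by rewrite ival0 mulr0 addr0 clamp0.
- by apply: cl; rewrite ival1; lra.
move=> t /=.
have [t2|/ltW t2] := leP (ival t) (1 / 2); first by rewrite loop_catl.
by rewrite loop_catr// cl// path_one.
Qed.

Lemma loop_catV f :
  homotopic_rel R [set zero; one] (loop_cat f (loop_rev f)) loop_cst.
Proof.
pose m t : R := Num.min (2 * ival t + 0) (-2 * ival t + 2).
have -> : (loop_cst : I -> X) = f \o cst zero.
  by apply/funext => t /=; rewrite path_zero.
apply: (@loop_reparam _ (fun t => clamp (m t)) (cst zero)).
- apply: (@continuous_compT _ _ _ _ clamp); last exact: clamp_cts.
  by apply: minR_cts; exact: aff_cts.
- exact: cst_continuous.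
- by rewrite /m ival0 min_l ?mulr0 ?addr0//; lra.
- by rewrite /m ival1 min_r ?mulr1 ?addNr//; lra.
move=> t /=; have t01 := ival_itv t.
have [t2|/ltW t2] := leP (ival t) (1 / 2).
  by rewrite loop_catl// /m min_l//; lra.
rewrite loop_catr// /m min_r; last by lra.
rewrite /= /mk_path /loop_rev_fun clamp_id; last by lra.
by congr (f (clamp _)); lra.
Qed.

Lemma loop_revK f : loop_rev (loop_rev f) = f.
Proof.
apply/path_eqP => t; rewrite /loop_rev /mk_path /= /loop_rev_fun /=.
rewrite /mk_path /loop_rev_fun; have t01 := ival_itv t.
rewrite clamp_id; last by lra.
by rewrite (_ : _ + _ = ival t) ?clampK//; lra.
Qed.

Definition pi1_one : pi1 := \pi_pi1 loop_cst.
Definition pi1_mul (a b : pi1) : pi1 := \pi_pi1 (loop_cat (repr a) (repr b)).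
Definition pi1_inv (a : pi1) : pi1 := \pi_pi1 (loop_rev (repr a)).

Lemma pi1_reprP f : homotopic_rel R [set zero; one] (repr (\pi_pi1 f)) f.
Proof. by apply/pi1P; rewrite reprK. Qed.

Lemma pi1_mulE f g : pi1_mul (\pi_pi1 f) (\pi_pi1 g) = \pi_pi1 (loop_cat f g).
Proof. by apply/pi1P; apply: loop_cat_homotopic; exact: pi1_reprP. Qed.

Lemma pi1_invE f : pi1_inv (\pi_pi1 f) = \pi_pi1 (loop_rev f).
Proof. by apply/pi1P; apply: loop_rev_homotopic; exact: pi1_reprP. Qed.

Lemma pi1_mulA : associative pi1_mul.
Proof.
elim/quotW=> f; elim/quotW=> g; elim/quotW=> h.
rewrite (pi1_mulE g h) (pi1_mulE f g) !pi1_mulE.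
by apply/esym/pi1P; exact: loop_catA.
Qed.

Lemma pi1_mul1l : left_id pi1_one pi1_mul.
Proof. by elim/quotW=> f; rewrite pi1_mulE; apply/pi1P; exact: loop_cat1l. Qed.

Lemma pi1_mul1r : right_id pi1_one pi1_mul.
Proof. by elim/quotW=> f; rewrite pi1_mulE; apply/pi1P; exact: loop_cat1r. Qed.

Lemma pi1_mulrV : right_inverse pi1_one pi1_inv pi1_mul.
Proof.
by elim/quotW=> f; rewrite pi1_invE pi1_mulE; apply/pi1P; exact: loop_catV.
Qed.

Lemma pi1_mulVr : left_inverse pi1_one pi1_inv pi1_mul.
Proof.
elim/quotW=> f; rewrite pi1_invE -{2}(loop_revK f) pi1_mulE.
by apply/pi1P; exact: loop_catV.
Qed.

HB.instance Definition _ := isGroup.Build pi1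
  pi1_mulA pi1_mul1l pi1_mul1r pi1_mulVr pi1_mulrV.

End FundamentalGroup.

Record pmap (X Y : ptopologicalType) := PMap {
  pmap_fun :> continuousType X Y;
  pmap_point : pmap_fun point = point }.

Section PointedMaps.
Context {X Y Z : ptopologicalType}.

Definition pmap_comp (g : pmap Y Z) (f : pmap X Y) : pmap X Z.
Proof.
refine (@PMap X Z (g \o f) _).
by rewrite /= !pmap_point.
Defined.

Definition pmap_id : pmap X X := @PMap X X idfun erefl.

Lemma pmap_cts (f : pmap X Y) : continuous f.
Proof. exact: cts_fun. Qed.

End PointedMaps.
Arguments pmap_id : clear implicits.

Section SelfEquivalences.
Variables (R : realType) (X : ptopologicalType).

(* Homotopy equivalence in the pointed category: the homotopy inverse and the
   homotopies are base-point preserving. *)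
Definition is_hequiv (Y : ptopologicalType) (f : pmap X Y) :=
  exists g : pmap Y X,
    homotopic_rel R [set point] (g \o f) (@idfun X) /\
    homotopic_rel R [set point] (f \o g) (@idfun Y).

Record self_hequiv := SelfHequiv {
  hequiv_map :> pmap X X;
  hequiv_mapP : is_hequiv hequiv_map }.

HB.instance Definition _ := gen_eqMixin self_hequiv.
HB.instance Definition _ := gen_choiceMixin self_hequiv.

Implicit Types f g h : self_hequiv.

Definition pointed_homotopic : rel self_hequiv :=
  fun f g => `[< homotopic_rel R [set point] f g >].

Lemma pointed_homotopic_refl : reflexive pointed_homotopic.
Proof. by move=> f; apply/asboolP; apply: homotopic_refl; exact: pmap_cts. Qed.

Lemma pointed_homotopic_sym : symmetric pointed_homotopic.
Proof. by move=> f g; apply/asboolP/asboolP; exact: homotopic_sym. Qed.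

Lemma pointed_homotopic_trans : transitive pointed_homotopic.
Proof.
by move=> g f h /asboolP fg /asboolP gh; apply/asboolP/(homotopic_trans fg).
Qed.

Canonical pointed_equiv := EquivRel pointed_homotopic pointed_homotopic_refl
  pointed_homotopic_sym pointed_homotopic_trans.

(* The group of self-homotopy equivalences: pointed homotopy classes of
   pointed self-equivalences, with [f] * [g] = [f \o g]. *)
Definition self_equiv := {eq_quot pointed_equiv}.

HB.instance Definition _ := Choice.on self_equiv.
HB.instance Definition _ := EqQuotient.on self_equiv.

Lemma self_equivP f g : \pi_self_equiv f = \pi_self_equiv g <->
  homotopic_rel R [set point] f g.
Proof. by split=> [/eqmodP/asboolP//|fg]; apply/eqmodP/asboolP. Qed.

Lemma self_equiv_reprP f :
  homotopic_rel R [set point] (repr (\pi_self_equiv f)) f.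
Proof. by apply/self_equivP; rewrite reprK. Qed.

Let whisker (f g g' : X -> X) (h : pmap X X) : f point = point ->
  continuous f -> homotopic_rel R [set point] g g' ->
  homotopic_rel R [set point] (h \o (g \o f)) (h \o (g' \o f)).
Proof.
move=> fp cf gg'; have hh := homotopic_refl R [set point] (@pmap_cts _ _ h).
have ff := homotopic_refl R [set point] cf.
have gg'f : homotopic_rel R [set point] (g \o f) (g' \o f).
  by apply: homotopic_comp ff gg' => x /= ->.
have gp x : [set point] x -> [set g point] ((g \o f) x) by move=> /= ->; rewrite fp.
by apply: (homotopic_comp gp gg'f); exact/homotopic_refl/pmap_cts.
Qed.

Lemma self_hequiv_comp_homotopic f f' g g' :
  homotopic_rel R [set point] f f' -> homotopic_rel R [set point] g g' ->
  homotopic_rel R [set point] (pmap_comp g f) (pmap_comp g' f').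
Proof. by apply: homotopic_comp => x /= ->; exact: pmap_point. Qed.

Lemma is_hequiv_id : is_hequiv (pmap_id X).
Proof.
have h : homotopic_rel R [set point] (@idfun X) (@idfun X).
  by apply: homotopic_refl => x; exact: cvg_id.
by exists (pmap_id X).
Qed.

Lemma is_hequiv_comp f g : is_hequiv (pmap_comp f g).
Proof.
have [f' [f'f ff']] := hequiv_mapP f; have [g' [g'g gg']] := hequiv_mapP g.
exists (pmap_comp g' f'); split.
- apply: homotopic_trans g'g.
  by apply: (whisker g' (pmap_point g) (@pmap_cts _ _ g) f'f).
- apply: homotopic_trans ff'.
  by apply: (whisker f (pmap_point f') (@pmap_cts _ _ f') gg').
Qed.

Definition self_hequiv_id := SelfHequiv is_hequiv_id.

Definition self_hequiv_comp f g := SelfHequiv (is_hequiv_comp f g).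

Lemma hequiv_inv_subproof f : exists g : self_hequiv,
  homotopic_rel R [set point] (g \o f) (@idfun X) /\
  homotopic_rel R [set point] (f \o g) (@idfun X).
Proof.
have [g [gf fg]] := hequiv_mapP f.
have gP : is_hequiv g by exists f.
by exists (SelfHequiv gP).
Qed.

Definition self_hequiv_inv f : self_hequiv := projT1 (cid (hequiv_inv_subproof f)).

Lemma self_hequiv_invl f :
  homotopic_rel R [set point] (self_hequiv_inv f \o f) (@idfun X).
Proof. by rewrite /self_hequiv_inv; case: cid => g []. Qed.

Lemma self_hequiv_invr f :
  homotopic_rel R [set point] (f \o self_hequiv_inv f) (@idfun X).
Proof. by rewrite /self_hequiv_inv; case: cid => g []. Qed.

Definition self_equiv_one : self_equiv := \pi_self_equiv self_hequiv_id.
Definition self_equiv_mul (a b : self_equiv) : self_equiv :=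
  \pi_self_equiv (self_hequiv_comp (repr a) (repr b)).
Definition self_equiv_inv (a : self_equiv) : self_equiv :=
  \pi_self_equiv (self_hequiv_inv (repr a)).

Lemma self_equiv_mulE f g :
  self_equiv_mul (\pi_self_equiv f) (\pi_self_equiv g) =
  \pi_self_equiv (self_hequiv_comp f g).
Proof.
by apply/self_equivP/self_hequiv_comp_homotopic; exact: self_equiv_reprP.
Qed.

Lemma self_equiv_mulA : associative self_equiv_mul.
Proof.
elim/quotW=> f; elim/quotW=> g; elim/quotW=> h.
rewrite (self_equiv_mulE g h) (self_equiv_mulE f g) !self_equiv_mulE.
by apply/self_equivP; apply: homotopic_refl; exact: pmap_cts.
Qed.

Lemma self_equiv_mul1l : left_id self_equiv_one self_equiv_mul.
Proof.
elim/quotW=> f; rewrite self_equiv_mulE.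
by apply/self_equivP; apply: homotopic_refl; exact: pmap_cts.
Qed.

Lemma self_equiv_mul1r : right_id self_equiv_one self_equiv_mul.
Proof.
elim/quotW=> f; rewrite self_equiv_mulE.
by apply/self_equivP; apply: homotopic_refl; exact: pmap_cts.
Qed.

Lemma self_equiv_mulVr :
  left_inverse self_equiv_one self_equiv_inv self_equiv_mul.
Proof.
move=> a; rewrite -{2}[a]reprK /self_equiv_inv self_equiv_mulE.
by apply/self_equivP; exact: self_hequiv_invl.
Qed.

Lemma self_equiv_mulrV :
  right_inverse self_equiv_one self_equiv_inv self_equiv_mul.
Proof.
move=> a; rewrite -{1}[a]reprK /self_equiv_inv self_equiv_mulE.
by apply/self_equivP; exact: self_hequiv_invr.
Qed.

HB.instance Definition _ := isGroup.Build self_equiv self_equiv_mulA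
  self_equiv_mul1l self_equiv_mul1r self_equiv_mulVr self_equiv_mulrV.

End SelfEquivalences.

Section InducedMap.
Context (R : realType) {X Y : ptopologicalType}.
Local Notation I := (unit_interval R).

Lemma pmap_loop_zero (f : pmap X Y) (l : loop R X) : (f \o l) zero = point.
Proof. by rewrite /= path_zero pmap_point. Qed.

Lemma pmap_loop_one (f : pmap X Y) (l : loop R X) : (f \o l) one = point.
Proof. by rewrite /= path_one pmap_point. Qed.

Lemma pmap_loop_cts (f : pmap X Y) (l : loop R X) : continuous (f \o l).
Proof. exact: cts_fun. Qed.

Definition pmap_loop (f : pmap X Y) (l : loop R X) : loop R Y :=
  mk_path (@pmap_loop_cts f l) (pmap_loop_zero f l) (pmap_loop_one f l).

Definition pi1_map (f : pmap X Y) (a : pi1 R X) : pi1 R Y :=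
  \pi_(pi1 R Y) (pmap_loop f (repr a)).

Lemma pmap_loop_homotopic (f f' : pmap X Y) (l l' : loop R X) :
  homotopic_rel R [set point] f f' ->
  homotopic_rel R [set zero; one] l l' ->
  homotopic_rel R [set zero; one] (pmap_loop f l) (pmap_loop f' l').
Proof.
move=> ff' ll'; have := homotopic_comp _ ll' ff'; apply=> t [] /= ->.
  by rewrite path_zero.
by rewrite path_one.
Qed.

Lemma pi1_mapE (f : pmap X Y) (l : loop R X) :
  pi1_map f (\pi_(pi1 R X) l) = \pi_(pi1 R Y) (pmap_loop f l).
Proof.
apply/pi1P/pmap_loop_homotopic; last exact: pi1_reprP.
by apply: homotopic_refl; exact: pmap_cts.
Qed.

Lemma pi1_map_homotopic (f f' : pmap X Y) :
  homotopic_rel R [set point] f f' -> pi1_map f =1 pi1_map f'.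
Proof.
move=> ff' a; apply/pi1P/pmap_loop_homotopic => //.
by apply: homotopic_refl; exact: cts_fun.
Qed.

Lemma pi1_mapM (f : pmap X Y) : {morph pi1_map f : a b / (a * b)%g}.
Proof.
elim/quotW=> l; elim/quotW=> m; rewrite [X in pi1_map f X]pi1_mulE !pi1_mapE.
rewrite [RHS]pi1_mulE; congr (\pi_(pi1 R Y) _); apply/path_eqP => t.
by rewrite /= /mk_path /loop_cat /mk_path /loop_cat_fun /=; case: ifP.
Qed.

End InducedMap.

(* Left actions by group automorphisms: each [gact g] is invertible with
   inverse [gact g^-1]. *)
Record group_action (G M : groupType) := GroupAction {
  gact :> G -> M -> M;
  gact1 : forall m, gact 1%g m = m;
  gactM : forall g h m, gact (g * h)%g m = gact g (gact h m);
  gact_morph : forall g, {morph gact g : m n / (m * n)%g} }.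

Section CanonicalAction.
Variables (R : realType) (X : ptopologicalType).

(* Independent of the representative of [c], see [self_equiv_actE]. *)
Definition self_equiv_act_fun (c : self_equiv R X) : pi1 R X -> pi1 R X :=
  pi1_map (repr c).

Lemma self_equiv_actE (f : self_hequiv R X) :
  self_equiv_act_fun (\pi_(self_equiv R X) f) =1 pi1_map f.
Proof. by apply: pi1_map_homotopic; exact: self_equiv_reprP. Qed.

Lemma self_equiv_act1 a : self_equiv_act_fun 1%g a = a.
Proof.
rewrite [LHS]self_equiv_actE; elim/quotW: a => l.
by rewrite pi1_mapE; congr (\pi_(pi1 R X) _); apply/path_eqP.
Qed.

Lemma self_equiv_actM c d a :
  self_equiv_act_fun (c * d)%g a = self_equiv_act_fun c (self_equiv_act_fun d a).
Proof.
elim/quotW: c => f; elim/quotW: d => g; elim/quotW: a => l.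
rewrite [X in self_equiv_act_fun X]self_equiv_mulE !self_equiv_actE.
rewrite (pi1_mapE g) (pi1_mapE f) pi1_mapE.
by congr (\pi_(pi1 R X) _); apply/path_eqP.
Qed.

Definition canonical_action : group_action (self_equiv R X) (pi1 R X) :=
  GroupAction self_equiv_act1 self_equiv_actM (fun c => pi1_mapM (repr c)).

End CanonicalAction.

Definition group_isom (G H : groupType) :=
  exists f : {multiplicative G -> H}, bijective f.

Definition action_equivalent (G G' M M' : groupType)
    (a : group_action G M) (a' : group_action G' M') :=
  exists (phi : {multiplicative G -> G'}) (psi : {multiplicative M -> M'}),
    [/\ bijective phi, bijective psi
      & forall g m, psi (a g m) = a' (phi g) (psi m)].

Section FreeGroup.
Variable n : nat.

(* The letter [(i, b)] stands for the generator [i] if [b] is [false] and for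
   its formal inverse if [b] is [true]. *)
Definition word := seq ('I_n * bool).

HB.instance Definition _ := Choice.on word.

Inductive word_equiv : word -> word -> Prop :=
| word_equiv_cancel u v i b :
    word_equiv (u ++ [:: (i, b); (i, ~~ b)] ++ v) (u ++ v)
| word_equiv_refl u : word_equiv u u
| word_equiv_sym u v : word_equiv u v -> word_equiv v u
| word_equiv_trans u v w : word_equiv u v -> word_equiv v w -> word_equiv u w.

Definition word_equivb : rel word := fun u v => `[< word_equiv u v >].

Lemma word_equivb_refl : reflexive word_equivb.
Proof. by move=> u; apply/asboolP; constructor. Qed.

Lemma word_equivb_sym : symmetric word_equivb.
Proof. by move=> u v; apply/asboolP/asboolP; exact: word_equiv_sym. Qed.

Lemma word_equivb_trans : transitive word_equivb.
Proof.
by move=> v u w /asboolP uv /asboolP vw; apply/asboolP/(word_equiv_trans uv).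
Qed.

Canonical word_equivR := EquivRel word_equivb word_equivb_refl
  word_equivb_sym word_equivb_trans.

Definition free_group := {eq_quot word_equivR}.

HB.instance Definition _ := Choice.on free_group.
HB.instance Definition _ := EqQuotient.on free_group.

Lemma free_groupP u v :
  \pi_free_group u = \pi_free_group v <-> word_equiv u v.
Proof. by split=> [/eqmodP/asboolP//|uv]; apply/eqmodP/asboolP. Qed.

Lemma free_group_reprP u : word_equiv (repr (\pi_free_group u)) u.
Proof. by apply/free_groupP; rewrite reprK. Qed.

Lemma word_equiv_cat u u' v v' :
  word_equiv u u' -> word_equiv v v' -> word_equiv (u ++ v) (u' ++ v').
Proof.
move=> uu' vv'; apply: (@word_equiv_trans _ (u' ++ v)).
  elim: uu' => {u u'} [u w i b|u|u w _|u w z _ IH _ IH'].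
  - by rewrite -!catA; exact: word_equiv_cancel.
  - exact: word_equiv_refl.
  - exact: word_equiv_sym.
  - exact: word_equiv_trans IH IH'.
elim: vv' => {v v'} [v w i b|v|v w _|v w z _ IH _ IH'].
- by rewrite !(catA u'); exact: word_equiv_cancel.
- exact: word_equiv_refl.
- exact: word_equiv_sym.
- exact: word_equiv_trans IH IH'.
Qed.

Definition word_inv (u : word) : word := rev [seq (x.1, ~~ x.2) | x <- u].

Lemma word_inv_cat u v : word_inv (u ++ v) = word_inv v ++ word_inv u.
Proof. by rewrite /word_inv map_cat rev_cat. Qed.

Lemma word_invK : involutive word_inv.
Proof.
move=> u; rewrite /word_inv map_rev revK -map_comp map_id_in// => -[i b] _ /=.
by rewrite negbK.
Qed.

Lemma word_inv_equiv u v :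
  word_equiv u v -> word_equiv (word_inv u) (word_inv v).
Proof.
elim=> {u v} [u v i b|u|u v _|u v w _ IH _ IH'].
- have e : word_inv [:: (i, b); (i, ~~ b)] = [:: (i, b); (i, ~~ b)].
    by rewrite /word_inv /= negbK.
  by rewrite !word_inv_cat -catA e; exact: word_equiv_cancel.
- exact: word_equiv_refl.
- exact: word_equiv_sym.
- exact: word_equiv_trans IH IH'.
Qed.

Lemma word_catV u : word_equiv (u ++ word_inv u) [::].
Proof.
elim: u => [|[i b] u IH]; first exact: word_equiv_refl.
rewrite -cat1s word_inv_cat -catA (catA u).
apply: (@word_equiv_trans _ ([:: (i, b)] ++ [::] ++ word_inv [:: (i, b)])).
  apply: word_equiv_cat; first exact: word_equiv_refl.
  by apply: word_equiv_cat => //; exact: word_equiv_refl.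
exact: (word_equiv_cancel [::] [::]).
Qed.

Definition free_one : free_group := \pi_free_group [::].
Definition free_mul (a b : free_group) : free_group :=
  \pi_free_group (repr a ++ repr b).
Definition free_inv (a : free_group) : free_group :=
  \pi_free_group (word_inv (repr a)).

Lemma free_mulE u v :
  free_mul (\pi_free_group u) (\pi_free_group v) = \pi_free_group (u ++ v).
Proof.
by apply/free_groupP/word_equiv_cat; exact: free_group_reprP.
Qed.

Lemma free_invE u :
  free_inv (\pi_free_group u) = \pi_free_group (word_inv u).
Proof. by apply/free_groupP/word_inv_equiv; exact: free_group_reprP. Qed.

Lemma free_mulA : associative free_mul.
Proof.
elim/quotW=> u; elim/quotW=> v; elim/quotW=> w.
by rewrite (free_mulE v w) (free_mulE u v) !free_mulE catA.
Qed.

Lemma free_mul1l : left_id free_one free_mul.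
Proof. by elim/quotW=> u; rewrite free_mulE. Qed.

Lemma free_mul1r : right_id free_one free_mul.
Proof. by elim/quotW=> u; rewrite free_mulE cats0. Qed.

Lemma free_mulrV : right_inverse free_one free_inv free_mul.
Proof.
elim/quotW=> u; rewrite free_invE free_mulE.
by apply/free_groupP; exact: word_catV.
Qed.

Lemma free_mulVr : left_inverse free_one free_inv free_mul.
Proof.
elim/quotW=> u; rewrite free_invE free_mulE -{2}(word_invK u).
by apply/free_groupP; exact: word_catV.
Qed.

HB.instance Definition _ := isGroup.Build free_group
  free_mulA free_mul1l free_mul1r free_mulVr free_mulrV.

End FreeGroup.

Inductive normal_closure (G : groupType) (A : set G) : set G :=
| normal_closure_sub x : A x -> normal_closure A x
| normal_closure_one : normal_closure A 1%g
| normal_closure_mul x y :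
    normal_closure A x -> normal_closure A y -> normal_closure A (x * y)%g
| normal_closure_inv x : normal_closure A x -> normal_closure A (x^-1)%g
| normal_closure_conj x y :
    normal_closure A x -> normal_closure A (x ^ y)%g.

(* [f] identifies [M] with the quotient of the free group on [n] generators by
   the normal closure of the finite list [rels]. *)
Definition finitely_presentable (M : groupType) :=
  exists (n : nat) (rels : seq (free_group n))
         (f : {multiplicative free_group n -> M}),
    (forall m, exists w, f w = m) /\
    (forall w, f w = 1%g <-> normal_closure [set` rels] w).

(* Main.v *)
(** X is the disjoint union, as a set, of a space Y with fundamental group M and of
    an infinite Alexandroff space Z of height one whose automorphism group is G,
    some open points of Z accumulating at every point of Y.

    Y is the quotient by M of the space E of step functions [0, 1) -> M, two step
    functions being close when they differ on a small set.  Cutting a step function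
    at t, with value 1 on [0, t), contracts E, and M acts on E by left translation;
    distinct translates differ everywhere, so E -> Y is a covering and pi_1(Y) = M,
    compatibly with the action of G on the values.

    Paths of X cannot leave Y, hence pi_1(X) = pi_1(Y).  Every point of Z lies in a
    finite subset without beat points, so a homotopy starting at the identity fixes
    Z.  A self-equivalence of X therefore restricts to an automorphism of Z, that is
    to the action of some g in G, and by density it agrees with g on Y, up to
    topologically indistinguishable points (Y is not T0), hence up to homotopy.

    Finite presentability is only used to make M countable, so that Y is separable. *)
Require Import Defs.
From HB Require Import structures.
From mathcomp Require Import all_boot all_order all_algebra fingroup.
From mathcomp Require Import generic_quotient.
From mathcomp Require Import all_classical reals topology normedtype.
From mathcomp Require Import homotopy.
From mathcomp Require Import ring lra zify.

Set Implicit Arguments.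
Unset Strict Implicit.
Unset Printing Implicit Defensive.

Import Order.TTheory GRing.Theory Num.Theory.
Import numFieldNormedType.Exports.

Local Open Scope classical_set_scope.
Local Open Scope ring_scope.
Local Open Scope quotient_scope.

(** * Step functions *)

Lemma inj_nat_unbounded (f : nat -> nat) N : injective f -> exists i, (N <= f i)%N.
Proof.
move=> injf; apply: contrapT => /forallNP fN.
suff: (size [seq f i | i <- iota 0 N.+1] <= size (iota 0 N))%N.
  by rewrite size_map !size_iota ltnn.
apply: uniq_leq_size; first by rewrite map_inj_uniq// iota_uniq.
by move=> _ /mapP[i _ ->]; rewrite mem_iota /= add0n ltnNge; exact/negP.
Qed.

Section StepFunctions.
Variables (R : realType) (M : groupType).

(* [(m, [:: (t1, m1); (t2, m2); ...])] stands for the function with value [m1] on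
   ]-oo, t1[, then [m2] on the rest of ]-oo, t2[, and so on, and finally [m]; only
   its restriction to [0, 1) matters. *)
Definition step := (M * seq (R * M))%type.
Implicit Types (x y z : step) (l : seq (R * M)) (m : M) (e d t : R) (n : nat).

Fixpoint step_rec m l (r : R) : M :=
  if l is tm :: l' then if r < tm.1 then tm.2 else step_rec m l' r else m.

Definition step_val x := step_rec x.1 x.2.

Definition diffs n x y : nat :=
  (\sum_(k < n) (step_val x (k%:R / n%:R) != step_val y (k%:R / n%:R)))%N.

(* The asymptotic proportion of the sample points [k / n] at which [x] and [y]
   differ is less than [e]; this replaces Lebesgue measure. *)
Definition near_step e x y := exists2 d, d < e &
  exists N, forall n, (N <= n)%N -> (diffs n x y)%:R <= d * n%:R.

Lemma near_step_refl e x : 0 < e -> near_step e x x.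
Proof.
move=> e0; exists 0 => //; exists 0%N => n _.
by rewrite /diffs big1 ?mul0r// => k _; rewrite eqxx.
Qed.

Lemma near_step_sym e x y : near_step e x y -> near_step e y x.
Proof.
move=> [d de [N dN]]; exists d => //; exists N => n /dN; congr (_%:R <= _).
by apply: eq_bigr => k _; rewrite eq_sym.
Qed.

Lemma diffs_trans n x y z : (diffs n x z <= diffs n x y + diffs n y z)%N.
Proof.
rewrite /diffs -big_split/=; apply: leq_sum => k _.
by case: (step_val x _ =P step_val y _) => [->|_]; [exact: leq_addl|]; case: (step_val x _ == _).
Qed.

Lemma near_step_trans y x z e d : near_step e x y -> near_step d y z -> near_step (e + d) x z.
Proof.
move=> [e' ee' [N eN]] [d' dd' [N' dN]]; exists (e' + d'); first exact: ltrD.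
exists (N + N')%N => n nN; rewrite mulrDl.
apply: (@le_trans _ _ (diffs n x y + diffs n y z)%:R).
  by rewrite ler_nat diffs_trans.
by rewrite natrD lerD// ?eN ?dN//; lia.
Qed.

Lemma near_step_le e d x y : e <= d -> near_step e x y -> near_step d x y.
Proof. by move=> ed [e' ee' eN]; exists e' => //; exact: lt_le_trans ee' ed. Qed.

(** The strict bound in [near_step] leaves room, which is what makes the balls open. *)
Lemma near_step_lt e x y : near_step e x y -> exists2 d, d < e & near_step d x y.
Proof.
move=> [d de H]; exists ((d + e) / 2); first by lra.
by exists d => //; lra.
Qed.

(** * Translation by [M], and its freeness *)

Definition step_map (f : M -> M) x : step :=
  (f x.1, [seq (tm.1, f tm.2) | tm <- x.2]).

Lemma step_mapE f x r : step_val (step_map f x) r = f (step_val x r).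
Proof. by case: x => m l; elim: l => //= -[t m'] l; rewrite /step_val /=; case: ifP. Qed.

Lemma near_step_map f e x y :
  injective f -> near_step e (step_map f x) (step_map f y) <-> near_step e x y.
Proof.
move=> injf; have E n : diffs n (step_map f x) (step_map f y) = diffs n x y.
  by apply: eq_bigr => k _; rewrite !step_mapE (inj_eq injf).
split=> -[d de [N dN]]; exists d => //; exists N => n.
  by rewrite -E; exact: dN.
by rewrite E; exact: dN.
Qed.

Definition step_act m := step_map (fun m' => m * m')%g.

Lemma step_act1 x : step_act 1%g x = x.
Proof.
case: x => m l; congr pair; rewrite ?mul1g//.
by elim: l => //= -[t m'] l ->; rewrite mul1g.
Qed.

Lemma step_actM m m' x : step_act (m * m')%g x = step_act m (step_act m' x).
Proof.
case: x => m0 l; rewrite /step_act /step_map /=; congr pair; rewrite -?mulgA//.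
by elim: l => //= -[t m1] l ->; rewrite mulgA.
Qed.

Lemma near_step_act m e x y : near_step e (step_act m x) (step_act m y) <-> near_step e x y.
Proof. by apply: near_step_map; exact: mulgI. Qed.

(** Distinct translates differ at every sample point, so no proportion below 1 bounds their
    difference. *)
Lemma near_step_free m m' x : near_step 1 (step_act m x) (step_act m' x) -> m = m'.
Proof.
move=> [d d1 [N dN]]; apply/eqP; apply: contraT => mm'; exfalso.
have := dN N.+1 (leqnSn _); apply/negP; rewrite -ltNge.
have -> : diffs N.+1 (step_act m x) (step_act m' x) = N.+1.
  rewrite /diffs (eq_bigr (fun=> 1%N)) ?sum1_card ?card_ord// => k _.
  by rewrite !step_mapE (inj_eq (@mulIg M _)) mm'.
by rewrite gtr_pMl// ltr0n.
Qed.

Lemma count_between (u v : R) n :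
  ((\sum_(k < n) (u <= k%:R < v)%R)%N)%:R <= Num.max 0 (v - u + 1).
Proof.
(* Strengthened for the induction: once some integer is counted, the count is also at most [n - u],
   which gives [v - u + 1] when the next integer [n] is below [v]. *)
have [|]: (\sum_(k < n) (u <= k%:R < v)%R)%N = 0%N \/
  ((\sum_(k < n) (u <= k%:R < v)%R)%N%:R <= n%:R - u /\
   (\sum_(k < n) (u <= k%:R < v)%R)%N%:R <= v - u + 1); last first.
- by move=> [_ h]; rewrite le_max h orbT.
- by move=> ->; rewrite le_max lexx.
elim: n => [|n IH]; first by left; rewrite big_ord0.
rewrite !big_ord_recr /=; move: IH; set c := (\sum_(_ < _) _)%N.
have [/andP[un nv]|_] := boolP (u <= n%:R < v).
  by rewrite addn1 -!natr1 => -[->|[? ?]]; right; split; lra.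
by rewrite addn0 -natr1 => -[->|[? ?]]; [left|right; split; lra].
Qed.

(* A sample point sees the two leading breakpoints differently only when it lies
   between [t] and [s]. *)
Lemma near_step_cons m t s x y e d : near_step e x y -> `|t - s| < d ->
  near_step (e + d) (x.1, (t, m) :: x.2) (y.1, (s, m) :: y.2).
Proof.
wlog st : t s x y / s <= t.
  move=> wl xy ts; have [st|/ltW ts'] := leP s t; first exact: wl.
  by apply/near_step_sym/wl => //; [exact/near_step_sym|rewrite distrC].
rewrite ger0_norm ?subr_ge0// => -[e' ee' [N eN]] td.
(* The midpoint between [t - s] and [d]: the slack [d' - (t - s)], times [n], absorbs the additive 1
   of [count_between] for large [n]. *)
have [d' d'E] : exists d', d' = (d + (t - s)) / 2 by eexists.
have d'd : d' < d by lra.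
exists (e' + d'); first exact: ltrD.
have dp : 0 < d' - (t - s) by lra.
have [K dK] : exists K : nat, (d' - (t - s))^-1 <= K%:R.
  by eexists; exact: ltW (truncnS_gt _).
exists (N + K.+1)%N => n nN.
have n0 : 0 < n%:R :> R by rewrite ltr0n; lia.
have nbig : 1 <= (d' - (t - s)) * n%:R.
  rewrite mulrC -ler_pdivrMr// div1r; apply: le_trans dK _.
  by rewrite ler_nat; lia.
have : (diffs n (x.1, (t, m) :: x.2) (y.1, (s, m) :: y.2) <=
   diffs n x y + \sum_(k < n) (s * n%:R <= k%:R < t * n%:R)%R)%N.
  rewrite /diffs -big_split/=; apply: leq_sum => k _.
  rewrite /step_val /= -ler_pdivlMr// -ltr_pdivrMr//.
  case: ltP => kt; case: ltP => ks; rewrite ?eqxx//=.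
  + exact: leq_trans (leq_b1 _) (leq_addl _ _).
  + by have := lt_le_trans ks st; rewrite ltNge kt.
  + exact: leq_addr.
rewrite -(ler_nat R) natrD => /le_trans; apply.
rewrite mulrDl lerD ?eN//; first by lia.
apply: le_trans (count_between _ _ _) _.
rewrite ge_max; apply/andP; split.
  by rewrite mulr_ge0 ?ler0n//; lra.
by rewrite -mulrBl; lra.
Qed.

Lemma near_step_eq e x y : 0 < e ->
  (forall r, 0 <= r < 1 -> step_val x r = step_val y r) -> near_step e x y.
Proof.
move=> e0 xy; exists 0 => //; exists 0%N => n _.
rewrite /diffs big1 ?mul0r// => k _; rewrite xy ?eqxx//.
have n0 : 0 < n%:R :> R by rewrite ltr0n; case: k; case: n.
by rewrite divr_ge0 ?ler0n//= ltr_pdivrMr// mul1r ltr_nat.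
Qed.

(** This and [near_step_cut0] are the two ends of the contraction. The step functions agree on [0,
    1), but the lists differ, so the ends are only indistinguishable. *)
Lemma near_step_cut1 m t x e : 0 < e -> 1 <= t ->
  near_step e (x.1, (t, m) :: x.2) (m, [::]).
Proof.
move=> e0 t1; apply: near_step_eq => // r /andP[_ r1].
by rewrite /step_val /= (lt_le_trans r1 t1).
Qed.

Lemma near_step_cut0 m t x e : 0 < e -> t <= 0 -> near_step e (x.1, (t, m) :: x.2) x.
Proof.
move=> e0 t1; apply: near_step_eq => // r /andP[r0 _].
by rewrite /step_val /= ltNge (le_trans t1 r0).
Qed.

(* [seq (R * M)] is the quotient of [step] by [M]: each orbit is represented by its
   element with final value [1]. *)
Definition step0 l : step := (1%g, l).
Definition step_proj x : seq (R * M) := (step_act x.1^-1%g x).2.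

Lemma step_proj0 l : step_proj (step0 l) = l.
Proof. by rewrite /step_proj invg1 step_act1. Qed.

Lemma step0_proj x : step0 (step_proj x) = step_act x.1^-1%g x.
Proof. by rewrite /step0 /step_proj /step_act /step_map /= mulVg. Qed.

Lemma step_projK x : step_act x.1 (step0 (step_proj x)) = x.
Proof. by rewrite step0_proj -step_actM mulgV step_act1. Qed.

Lemma step_proj_act m x : step_proj (step_act m x) = step_proj x.
Proof.
rewrite /step_proj (_ : (step_act m x).1 = (m * x.1)%g)// invMg -step_actM.
by rewrite -mulgA mulVg mulg1.
Qed.

(** Translation preserves closeness, so moving one of the two representatives suffices to compare
    orbits. *)
Definition near_proj e l l' := exists m, near_step e (step0 l) (step_act m (step0 l')).

Lemma near_step_proj e x y : near_step e x y -> near_proj e (step_proj x) (step_proj y).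
Proof.
rewrite -{1}(step_projK x) -{1}(step_projK y) => xy.
exists (x.1^-1 * y.1)%g; apply: (iffLR (near_step_act x.1 _ _ _)).
by rewrite -step_actM mulgA mulgV mul1g.
Qed.

Lemma near_step_step0 e l l' : near_step e (step0 l) (step0 l') -> near_proj e l l'.
Proof. by move=> ll'; exists 1%g; rewrite step_act1. Qed.

Lemma near_proj_refl e l : 0 < e -> near_proj e l l.
Proof. by move=> e0; apply: near_step_step0; exact: near_step_refl. Qed.

Lemma near_proj_sym e l l' : near_proj e l l' -> near_proj e l' l.
Proof.
move=> [m ml]; exists m^-1%g; apply: (iffLR (near_step_act m _ _ _)).
by rewrite -step_actM mulgV step_act1; exact: near_step_sym.
Qed.

Lemma near_proj_trans l' l l'' e d :
  near_proj e l l' -> near_proj d l' l'' -> near_proj (e + d) l l''.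
Proof.
move=> [m ml] [m' ml']; exists (m * m')%g; apply: near_step_trans ml _.
by rewrite step_actM; apply/near_step_act.
Qed.

Lemma near_proj_le e d l l' : e <= d -> near_proj e l l' -> near_proj d l l'.
Proof. by move=> ed [m ml]; exists m; exact: near_step_le ml. Qed.

Lemma near_proj_lt e l l' : near_proj e l l' -> exists2 d, d < e & near_proj d l l'.
Proof. by move=> [m /near_step_lt[d de ml]]; exists d => //; exists m. Qed.

(* [L] lists the step functions with rational breakpoints, each infinitely often. *)
Lemma step_dense (en : nat -> M) : (forall m, exists k, en k = m) ->
  exists L : nat -> seq (R * M),
    forall l e N, 0 < e -> exists2 n, (N <= n)%N & near_proj e l (L n).
Proof.
move=> en_surj; pose dec (c : nat * seq (rat * nat)) : seq (R * M) :=
  [seq (ratr qk.1, en qk.2) | qk <- c.2].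
exists (fun n => if unpickle n is Some c then dec c else [::]) => l e N e0.
have [c cP] : exists c, near_step e (step0 l) (step0 (dec (0%N, c))).
  elim: l e e0 => [|[t m] l IH] e e0; first by exists [::]; exact: near_step_refl.
  have [|c lc] := IH (e / 2); first by lra.
  have [|q /=] := @rat_in_itvoo R (t - e / 2) (t + e / 2); first by lra.
  rewrite in_itv /= => /andP[q1 q2]; have [k <-] := en_surj m.
  exists ((q, k) :: c); rewrite [e]splitr; apply: (near_step_cons (en k) lc).
  by rewrite ltr_norml; apply/andP; split; lra.
have [|i iN] := @inj_nat_unbounded (fun i : nat => pickle (i, c)) N.
  by move=> i j /(pcan_inj pickleK)[].
exists (pickle (i, c)) => //=; rewrite pickleK; exact: near_step_step0.
Qed.

End StepFunctions.

(** * The unit interval and square *)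

Section UnitInterval.
Variable R : realType.
Local Notation I := (unit_interval R).
Implicit Types (s t : I) (u v w : I * I) (r : R).

Lemma clamp_setT : @clamp R @` `[0, 1] = [set: I].
Proof.
apply/seteqP; split=> // t _; exists (ival t); last exact: clampK.
by rewrite /= in_itv; exact: ival_itv.
Qed.

Lemma unit_interval_connected : connected [set: I].
Proof.
rewrite -clamp_setT; apply: connected_continuous_connected (@segment_connected _ _ _) _.
exact/continuous_subspaceT/clamp_cts.
Qed.

Lemma unit_interval_compact : compact [set: I].
Proof.
rewrite -clamp_setT; apply: continuous_compact; last exact: segment_compact.
exact/continuous_subspaceT/clamp_cts.
Qed.

(** Connectedness as an induction principle: [P] defines a clopen set. *)
Lemma unit_interval_ind (P : I -> Prop) t : P t ->
  (forall s, P s -> \forall s' \near s, P s') ->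
  (forall s, ~ P s -> \forall s' \near s, ~ P s') -> forall s, P s.
Proof.
move=> Pt Po nPo s; have oP : open [set s | P s] by rewrite openE => ?; exact: Po.
have oN : open [set s | ~ P s] by rewrite openE => ?; exact: nPo.
have cP : closed [set s | P s].
  rewrite (_ : [set s | P s] = ~` [set s | ~ P s]); first exact: open_closedC.
  by apply/seteqP; split=> x /= => [?|/contrapT].
have := @unit_interval_connected [set s | P s]; rewrite -[P s]/([set s | P s] s).
move=> ->//; first by exists t.
- by exists [set s | P s] => //; rewrite setTI.
- by exists [set s | P s] => //; rewrite setTI.
Qed.

Lemma unit_interval_locally_const (T : Type) (c : I -> T) :
  (forall t, \forall s \near t, c s = c t) -> forall t, c t = c zero.
Proof.
move=> cc; apply: (@unit_interval_ind (fun t => c t = c zero) zero) => // t.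
  by move=> <-; exact: cc.
by move=> tz; apply: filterS (cc t) => s ->.
Qed.

Lemma nbhs_ival t (A : set I) : nbhs t A ->
  exists2 d, 0 < d & forall s, `|ival s - ival t| < d -> A s.
Proof.
move=> nA; have : nbhs (ival t) (@clamp R @^-1` A).
  by have := @clamp_cts R (ival t) A; rewrite clampK; apply.
move=> /nbhs_ballP[d /= d0 dA]; exists d => // s sd.
by rewrite -(clampK s); apply: dA; rewrite /ball /= distrC.
Qed.

Lemma near_ival t d : 0 < d -> \forall s \near t, `|ival s - ival t| < d.
Proof.
move=> d0; have /cvgrPdistC_lt := @ival_cts R t; exact.
Qed.

Definition square_close r u v :=
  `|ival u.1 - ival v.1| <= r /\ `|ival u.2 - ival v.2| <= r.

Lemma square_close_refl r u : 0 <= r -> square_close r u u.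
Proof. by move=> r0; rewrite /square_close !subrr normr0. Qed.

Lemma square_close_le r r' u v : r <= r' -> square_close r u v -> square_close r' u v.
Proof. by move=> rr' [h k]; split; lra. Qed.

Lemma square_close_trans r r' v u w :
  square_close r u v -> square_close r' v w -> square_close (r + r') u w.
Proof.
move=> [h k] [h' k']; split.
- by apply: le_trans (ler_distD (ival v.1) _ _) _; lra.
- by apply: le_trans (ler_distD (ival v.2) _ _) _; lra.
Qed.

Lemma near_square_close u r : 0 < r -> \forall v \near u, square_close r u v.
Proof.
case: u => s t r0; near=> v; split => /=; rewrite distrC; apply: ltW; near: v.
- exact: (cvg_fst (near_ival s r0)).
- exact: (cvg_snd (near_ival t r0)).
Unshelve. all: by end_near. Qed.

Lemma nbhs_square_close u (A : set (I * I)) : nbhs u A ->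
  exists2 d, 0 < d & forall v, square_close d u v -> A v.
Proof.
case: u => s t [[A1 A2] /= [/nbhs_ival[d d0 dA] /nbhs_ival[d' d'0 d'A]] AA].
have [e [e0 ed ed']] : exists e, [/\ 0 < e, e <= d & e <= d'].
  by exists (Num.min d d'); rewrite lt_min d0 d'0 !ge_min !lexx orbT.
exists (e / 2); first by lra.
move=> [s' t'] /= [h k]; apply: AA; split=> /=.
- by apply: dA; rewrite distrC; move: h => /=; lra.
- by apply: d'A; rewrite distrC; move: k => /=; lra.
Qed.

(** The Lebesgue number lemma for pairs of points. The factor 2 allows in [square_lift] for one
    subdivision step together with a displacement of the end point, each of size [1 / N.+1]. *)
Lemma square_lebesgue (P : I * I -> I * I -> Prop) :
  (forall u, exists2 d, 0 < d & forall v w, square_close d u v -> square_close d u w -> P v w) ->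
  exists N, forall u v, square_close (2 / N.+1%:R) u v -> P u v.
Proof.
move=> Pu; have /compact_near_coveringP := compact_setX unit_interval_compact unit_interval_compact.
rewrite setXTT => /(_ nat \oo (fun n u => forall v, square_close (2 / n.+1%:R) u v -> P u v)).
case=> [u _|N _ /(_ N (leqnn _)) NP]; last by exists N => u v; apply: NP.
have [d d0 dP] := Pu u; exists ([set v | square_close (d / 2) u v],
   [set n | 2 / n.+1%:R <= d / 2]) => /=; last first.
  move=> [v n] /= [uv nd] w vw; apply: dP; first by apply: square_close_le uv; lra.
  by rewrite [d]splitr; apply: square_close_trans uv _; exact: square_close_le vw.
split; first by apply: near_square_close; lra.
near=> n => /=; rewrite ler_pdivrMr// mulrC -ler_pdivrMr; last by lra.
apply: le_trans (_ : n%:R <= _); last by rewrite ler_nat.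
by near: n; exact: nbhs_infty_ger.
Unshelve. all: by end_near. Qed.

Definition shrink r u : I * I := (clamp (r * ival u.1), clamp (r * ival u.2)).

Lemma shrink0 u : shrink 0 u = (zero, zero).
Proof. by rewrite /shrink !mul0r clamp0. Qed.

Lemma shrink1 u : shrink 1 u = u.
Proof. by rewrite /shrink !mul1r !clampK -surjective_pairing. Qed.

Lemma shrink_zero r : shrink r (zero, zero) = (zero, zero).
Proof. by rewrite /shrink /= ival0 mulr0 clamp0. Qed.

Lemma square_close_shrink r r' d e u v : 0 <= r <= 1 -> 0 <= r' <= 1 ->
  `|r - r'| <= e -> square_close d u v -> square_close (d + e) (shrink r u) (shrink r' v).
Proof.
move=> r01 r'01 rr' [h k].
have E (a b : I) : `|ival a - ival b| <= d ->
    `|ival (clamp (r * ival a)) - ival (clamp (r' * ival b))| <= d + e.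
  move=> ab; have a01 := ival_itv a; have b01 := ival_itv b.
  rewrite !clamp_id; [|nra..].
  rewrite (_ : _ - _ = r * (ival a - ival b) + (r - r') * ival b); last by ring.
  apply: le_trans (ler_normD _ _) _; rewrite !normrM.
  rewrite (ger0_norm (_ : 0 <= r)) ?(ger0_norm (_ : 0 <= ival b)); [|lra..].
  have := normr_ge0 (r - r'); have := normr_ge0 (ival a - ival b).
  by move=> ? ?; apply: lerD; nra.
by split; exact: E.
Qed.

End UnitInterval.

(** * Lifting paths and homotopies *)

Section Lifting.
Variables (R : realType) (M : groupType).
Local Notation I := (unit_interval R).
Local Notation E := (step R M).
Local Notation Y := (seq (R * M)).

Definition econt (T : topologicalType) (F : T -> E) :=
  forall u e, 0 < e -> \forall v \near u, near_step e (F u) (F v).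

Definition ycont (T : topologicalType) (F : T -> Y) :=
  forall u e, 0 < e -> \forall v \near u, near_proj e (F u) (F v).

Lemma econt_comp (T U : topologicalType) (f : T -> U) (F : U -> E) :
  continuous f -> econt F -> econt (F \o f).
Proof. by move=> cf cF u e e0; exact: cf u _ (cF (f u) e e0). Qed.

Lemma ycont_comp (T U : topologicalType) (f : T -> U) (F : U -> Y) :
  continuous f -> ycont F -> ycont (F \o f).
Proof. by move=> cf cF u e e0; exact: cf u _ (cF (f u) e e0). Qed.

Lemma econt_act (T : topologicalType) (F : T -> E) m :
  econt F -> econt (fun u => step_act m (F u)).
Proof. by move=> cF u e e0; apply: filterS (cF u e e0) => v; rewrite near_step_act. Qed.

Lemma econt_proj (T : topologicalType) (F : T -> E) :
  econt F -> ycont (fun u => step_proj (F u)).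
Proof. by move=> cF u e e0; apply: filterS (cF u e e0) => v; exact: near_step_proj. Qed.

Lemma econt_cst (T : topologicalType) (x : E) : econt (fun=> x : E) (T := T).
Proof. by move=> u e e0; apply: filterE => v; exact: near_step_refl. Qed.

(* Two points of [Y] at distance less than [1 / 4] determine a transition
   element of [M]; the lift at [u] multiplies these along [N] equal steps of
   the segment from the corner of the square to [u]. *)
Lemma square_lift (F : I * I -> Y) : ycont F -> exists F' : I * I -> E,
  [/\ econt F', forall u, step_proj (F' u) = F u
    & F' (zero, zero) = step0 (F (zero, zero))].
Proof.
move=> cF; pose near u v m := near_step (1 / 4) (step0 (F u)) (step_act m (step0 (F v))).
have [N NP] : exists N, forall u v, square_close (2 / N.+1%:R) u v -> exists m, near u v m.
  apply: square_lebesgue => u; have [|d d0 dF] := nbhs_square_close (cF u (1 / 8) _); first by lra.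
  exists d => // v w /dF uv /dF uw;suff: near_proj (1 / 4) (F v) (F w) by [].
  apply: near_proj_le (near_proj_trans (near_proj_sym uv) uw); lra.
set n := N.+1%:R in NP; have n0 : 0 < n :> R by rewrite ltr0n.
pose c u v := xget 1%g [set m | near u v m].
have cP u v m : near u v m -> near u v (c u v).
  by move=> h; exact: (xgetI 1%g (h : [set m | near u v m] m)).
have cE u v m : near u v m -> c u v = m.
  move=> uv; apply: (@near_step_free R M _ _ (step0 (F v))).
  apply: near_step_le (near_step_trans (near_step_sym (cP _ _ _ uv)) uv); lra.
(* The cocycle relation: three distances below [1 / 4] add up to less than 1, where freeness
   applies. *)
have cM u v w : square_close (2 / n) u v -> square_close (2 / n) v w -> square_close (2 / n) u w ->
    (c u v * c v w)%g = c u w.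
  move=> /NP[a /cP uv] /NP[b /cP vw] /NP[d /cP uw].
  apply: (@near_step_free R M _ _ (step0 (F w))); rewrite step_actM.
  have h : near_step (1 / 4) (step_act (c u v) (step0 (F v)))
    (step_act (c u v) (step_act (c v w) (step0 (F w)))) by exact/near_step_act.
  have := near_step_trans (near_step_trans (near_step_sym h) (near_step_sym uv)) uw.
  by apply: near_step_le; lra.
have c1 u : c u u = 1%g by apply: cE; rewrite /near step_act1; apply: near_step_refl; lra.
pose s k u := shrink (k%:R / n) u.
pose P := fix P k u {struct k} : M :=
  if k is k'.+1 then (P k' u * c (s k' u) (s k'.+1 u))%g else 1%g.
have k01 k : (k <= N.+1)%N -> 0 <= k%:R / n <= 1.
  by move=> kN; rewrite divr_ge0 ?ler0n//= ler_pdivrMr// mul1r ler_nat.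
have n10 : 0 <= 1 / n by rewrite divr_ge0.
have E2 : 2 / n = 1 / n + 1 / n by rewrite -mulrDl.
have sk k u v : (k <= N.+1)%N -> square_close (1 / n) u v -> square_close (2 / n) (s k u) (s k v).
  move=> kN uv; rewrite E2; apply: square_close_shrink => //; try exact: k01.
  by rewrite subrr normr0.
have skS k u v : (k.+1 <= N.+1)%N -> square_close (1 / n) u v ->
    square_close (2 / n) (s k u) (s k.+1 v).
  move=> kN uv; rewrite E2; apply: square_close_shrink => //; try by apply: k01; lia.
  rewrite -mulrBl -natr1 opprD addrA subrr sub0r normrM normrN normr1.
  by rewrite ger0_norm ?mul1r ?invr_ge0// ltW.
(* The ladder between the segments to [u] and to [v] is cut into triangles small enough for the
   cocycle relation. *)
have PE k u v : (k <= N.+1)%N -> square_close (1 / n) u v ->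
    (P k u * c (s k u) (s k v))%g = P k v.
  elim: k => [|k IH] kN uv; first by rewrite /s mul0r !shrink0 c1 mulg1.
  have cl w : square_close (1 / n) w w := square_close_refl w n10.
  rewrite /= -IH//; last by lia.
  rewrite -!mulgA; congr mulg.
  have kN' := ltnW kN.
  rewrite (cM (s k u) (s k.+1 u) (s k.+1 v) (skS k u u kN (cl u))
     (sk k.+1 u v kN uv) (skS k u v kN uv)).
  by rewrite (cM (s k u) (s k v) (s k.+1 v) (sk k u v kN' uv)
     (skS k v v kN (cl v)) (skS k u v kN uv)).
exists (fun u => step_act (P N.+1 u) (step0 (F u))); split.
(* The bound [1 / 4] identifies [m] with the transition element [c u v]. *)
- move=> u e e0; pose e' := Num.min e (1 / 4).
  have e'0 : 0 < e' by rewrite lt_min e0; lra.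
  have := cF u e' e'0; have : \forall v \near u, square_close (1 / n) u v.
    by apply: near_square_close; rewrite divr_gt0.
  apply: filterS2 => v uv [m uvm].
  have sN w : s N.+1 w = w by rewrite /s divff ?shrink1// gt_eqF.
  rewrite -(PE N.+1 u v (leqnn _) uv) !sN step_actM; apply/near_step_act.
  rewrite (cE u v m); first by apply: near_step_le uvm; rewrite ge_min lexx.
  by apply: near_step_le uvm; rewrite ge_min lexx orbT.
- by move=> u; rewrite step_proj_act step_proj0.
- rewrite (_ : P N.+1 _ = 1%g) ?step_act1//.
  by elim: N.+1 => //= k ->; rewrite /s !shrink_zero c1 mulg1.
Qed.

(** The element [c t] carrying one lift to the other is locally constant by freeness, hence
    constant. *)
Lemma path_lift_unique (f g : I -> E) : econt f -> econt g ->
  (forall t, step_proj (f t) = step_proj (g t)) -> f zero = g zero -> f =1 g.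
Proof.
move=> cf cg fg fg0; pose c t := ((g t).1 * (f t).1^-1)%g.
have gE t : g t = step_act (c t) (f t).
  by rewrite step_actM -step0_proj fg step_projK.
have c0 : c zero = 1%g by rewrite /c fg0 mulgV.
have cc t : \forall s \near t, c s = c t.
  have hf : \forall s \near t, near_step (1 / 2) (f t) (f s) by apply: cf; lra.
  have hg : \forall s \near t, near_step (1 / 2) (g t) (g s) by apply: cg; lra.
  apply: filterS2 hg hf => s gg ff.
  apply: (@near_step_free R M _ _ (f s)).
  rewrite (_ : 1 = 1 / 2 + 1 / 2); last by lra.
  rewrite -gE; apply: near_step_trans (near_step_sym gg) _.
  by rewrite gE; apply/near_step_act.
by move=> t; rewrite gE (unit_interval_locally_const cc) c0 step_act1.
Qed.

Definition path_lift (f : I -> Y) (f' : I -> E) :=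
  econt f' /\ forall t, step_proj (f' t) = f t.

(** A path is lifted as a map on the square that is constant in the first variable. *)
Lemma path_lift_exists (f : I -> Y) : ycont f ->
  exists2 f', path_lift f f' & f' zero = step0 (f zero).
Proof.
move=> cf; have [F [cF Ff F0]] := square_lift (ycont_comp (@continuous_snd I I) cf).
exists (fun t => F (zero, t)) => //; split=> [|t]; last by rewrite Ff.
exact: econt_comp (continuous_pair (@cst_continuous _ _ _) (fun x => cvg_id)) cF.
Qed.

End Lifting.

(** * A graph with automorphism group G *)

(* For each [g] the nodes [Chain g i] and [Leaf g j] form a half graph, which is
   rigid; the links encode right multiplication in [G]. *)
Inductive node (G : Type) :=
| Chain of G & nat
| Leaf of G & nat
| Link of G & G.

HB.instance Definition _ (G : Type) := gen_eqMixin (node G).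

(** The specialization order: leaves are the open points. A link is recognised by its two ends, of
    index 0 at [g] and of positive index, encoding [s], at [g * s]; the successor keeps the ends
    distinct even when [s] is 1. *)
Definition adj (G : finGroupType) (c b : node G) : Prop :=
  match c, b with
  | Chain g i, Leaf h j => g = h /\ (i <= j)%N
  | Link g s, Leaf h j =>
      (h = g /\ j = 0%N) \/ (h = (g * s)%g /\ j = (enum_rank s).+1)
  | _, _ => False
  end.

Section Node.
Variable G : finGroupType.
Implicit Types (z c b : node G) (S : seq (node G)) (g s : G).

Lemma adj_leaf c b : adj c b -> exists g n, b = Leaf g n.
Proof. by case: c b => [? ?|? ?|? ?] [? ?|g n|? ?] //= _; exists g, n. Qed.

Lemma adj_irr c b z : adj c b -> ~ adj b z.
Proof. by move=> /adj_leaf[g [n ->]]. Qed.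

(** In height one, a beat point has a single neighbour; two distinct neighbours in [S] rule this
    out. *)
Definition no_beat_point S := forall z, z \in S ->
  (exists b b', [/\ b != b', b \in S, b' \in S, adj z b & adj z b']) \/
  (exists c c', [/\ c != c', c \in S, c' \in S, adj c z & adj c' z]).

Lemma no_beat_point_cat S S' :
  no_beat_point S -> no_beat_point S' -> no_beat_point (S ++ S').
Proof.
move=> nS nS' z; rewrite mem_cat => /orP[/nS|/nS'] [[b [b' []]]|[c [c' []]]] *.
- by left; exists b, b'; rewrite !mem_cat; split=> //; apply/orP; left.
- by right; exists c, c'; rewrite !mem_cat; split=> //; apply/orP; left.
- by left; exists b, b'; rewrite !mem_cat; split=> //; apply/orP; right.
- by right; exists c, c'; rewrite !mem_cat; split=> //; apply/orP; right.
Qed.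

Lemma no_beat_point_cons z b b' S : no_beat_point S -> b != b' ->
  b \in S -> b' \in S -> adj z b -> adj z b' -> no_beat_point (z :: S).
Proof.
move=> nS bb' bS b'S zb zb' w; rewrite inE => /predU1P[->|/nS].
  by left; exists b, b'; rewrite !inE bS b'S !orbT.
by move=> [[d [d' []]]|[c [c' []]]] *; [left; exists d, d'|right; exists c, c'];
  rewrite !inE; split=> //; apply/orP; right.
Qed.

Lemma no_beat_point_cycle c c' b b' : c != c' -> b != b' -> adj c b ->
  adj c b' -> adj c' b -> adj c' b' -> no_beat_point [:: c; c'; b; b'].
Proof.
move=> cc' bb' cb cb' c'b c'b' z; rewrite !inE => /or4P[]/eqP->.
- by left; exists b, b'; rewrite !inE !eqxx !orbT.
- by left; exists b, b'; rewrite !inE !eqxx !orbT.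
- by right; exists c, c'; rewrite !inE !eqxx !orbT.
- by right; exists c, c'; rewrite !inE !eqxx !orbT.
Qed.

Lemma node_no_beat_point z : exists2 S, no_beat_point S & z \in S.
Proof.
have leaf g n : exists2 S, no_beat_point S & Leaf g n \in S.
  case: n => [|n].
    (* [Leaf g 0] has only [Chain g 0] below it in its half graph; the link labelled 1 closes a
       cycle through a second leaf over [g]. *)
    exists [:: Chain g 0; Link g 1%g; Leaf g 0; Leaf g (enum_rank (1%g : G)).+1].
      apply: no_beat_point_cycle => //=; try by [apply/eqP|left].
      by right; rewrite mulg1.
    by rewrite !inE eqxx !orbT.
  exists [:: Chain g 0; Chain g 1; Leaf g n.+1; Leaf g n.+2].
    apply: no_beat_point_cycle => //; apply/eqP => -[]; lia.
  by rewrite !inE eqxx !orbT.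
case: z => [g i|g n|g s]; last 1 first.
- have [S nS gS] := leaf g 0%N; have [S' nS' gS'] := leaf (g * s)%g (enum_rank s).+1.
  exists (Link g s :: (S ++ S')); last by rewrite inE eqxx.
  apply: (@no_beat_point_cons _ (Leaf g 0) (Leaf (g * s)%g (enum_rank s).+1)).
  + exact: no_beat_point_cat.
  + by apply/eqP.
  + by rewrite mem_cat gS.
  + by rewrite mem_cat gS' orbT.
  + by left.
  + by right.
- exists [:: Chain g i; Chain g i.+1; Leaf g i.+1; Leaf g i.+2].
    apply: no_beat_point_cycle; rewrite /=; try by [split=> //; lia].
      by apply/eqP => -[]; lia.
    by apply/eqP => -[]; lia.
  by rewrite !inE eqxx.
- exact: leaf.
Qed.

(** * Rigidity: the automorphisms of the graph *)

Definition node_act g z :=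
  match z with
  | Chain h i => Chain (g * h)%g i
  | Leaf h n => Leaf (g * h)%g n
  | Link h s => Link (g * h)%g s
  end.

Lemma node_act1 z : node_act 1%g z = z.
Proof. by case: z => * /=; rewrite mul1g. Qed.

Lemma node_actM g h z : node_act (g * h)%g z = node_act g (node_act h z).
Proof. by case: z => * /=; rewrite mulgA. Qed.

Lemma node_act_adj g c b : adj c b -> adj (node_act g c) (node_act g b).
Proof.
case: c b => [h i|h i|h i] [k j|k j|k j] //=; first by move=> [-> ?].
by move=> [[-> ->]|[-> ->]]; [left|right; rewrite mulgA].
Qed.

Lemma node_hom_shape (f : node G -> node G) : injective f ->
  (forall c b, adj c b -> adj (f c) (f b)) ->
  exists phi beta psi, forall g,
    [/\ forall i, f (Chain g i) = Chain (phi g) (beta g i),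
        forall n, f (Leaf g n) = Leaf (phi g) (psi g n),
        forall n, (n <= psi g n)%N
      & forall i n, (i <= n)%N -> (beta g i <= psi g n)%N].
Proof.
move=> injf fadj.
have chain g i : exists h j, f (Chain g i) = Chain h j.
  have a n : (i <= n)%N -> adj (f (Chain g i)) (f (Leaf g n)) by move=> ?; apply: fadj.
  case E : (f (Chain g i)) a => [h j|h j|h s] a; first by exists h, j.
    by have := a i (leqnn _).
  (* A link has only two leaves above it, too few for the distinct images of the leaves of index
     [i], [i + 1] and [i + 2]. *)
  pose b n := if n is 0 then Leaf h 0 else Leaf (h * s)%g (enum_rank s).+1.
  have {}a n : (i <= n)%N -> f (Leaf g n) = b 0%N \/ f (Leaf g n) = b 1%N.
    move=> /a an; have [h' [m e]] := adj_leaf an.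
    by move: an; rewrite e => -[[-> ->]|[-> ->]]; [left|right].
  have n01 : f (Leaf g i) <> f (Leaf g i.+1) by move=> /injf[]; lia.
  have n02 : f (Leaf g i) <> f (Leaf g i.+2) by move=> /injf[]; lia.
  have n12 : f (Leaf g i.+1) <> f (Leaf g i.+2) by move=> /injf[]; lia.
  have := a i (leqnn _); have := a i.+1 (leqnSn _).
  have := a i.+2 (ltnW (leqnSn _)).
  by move=> [] e2 [] e1 [] e0; exfalso; congruence.
have [phi0 phi0P] := choice (fun gi : G * nat => chain gi.1 gi.2).
have [beta0 beta0P] := choice phi0P.
pose phi g := phi0 (g, 0%N); pose beta g i := beta0 (g, i).
have leaf g n : exists j, f (Leaf g n) = Leaf (phi g) j.
  have := fadj (Chain g 0) (Leaf g n) (conj erefl (leq0n _)).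
  rewrite (beta0P (g, 0%N)) => an; have [h [m e]] := adj_leaf an.
  by exists m; move: an; rewrite e => -[<-].
have [psi0 psi0P] := choice (fun gi : G * nat => leaf gi.1 gi.2).
pose psi g i := psi0 (g, i); exists phi, beta, psi => g.
have fL n : f (Leaf g n) = Leaf (phi g) (psi g n) := psi0P (g, n).
have fC i : f (Chain g i) = Chain (phi g) (beta g i) /\
    forall n, (i <= n)%N -> (beta g i <= psi g n)%N.
  have H n : (i <= n)%N -> adj (f (Chain g i)) (f (Leaf g n)) by move=> ?; apply: fadj.
  have E := beta0P (g, i); rewrite /= in E.
  have [e _] : adj (Chain (phi0 (g, i)) (beta0 (g, i))) (Leaf (phi g) (psi g i)).
    by rewrite -E -fL; exact: H.
  rewrite E e; split=> // n /H; rewrite fL E e; by case.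
have le i n : (i <= n)%N -> (beta g i <= psi g n)%N by exact: (fC i).2.
split=> // [i|n]; first exact: (fC i).1.
(* The [n + 1] chain points below [Leaf g n] have distinct images among the [psi g n + 1] chain
   points below its image. *)
suff: (size [seq beta g i | i <- iota 0 n.+1] <= size (iota 0 (psi g n).+1))%N.
  by rewrite size_map !size_iota.
apply: uniq_leq_size.
  rewrite map_inj_uniq ?iota_uniq// => i j ij.
  have e : f (Chain g i) = f (Chain g j).
    by rewrite (fC i).1 (fC j).1 -/(beta g i) ij.
  by have [] := injf _ _ e.
by move=> _ /mapP[i + ->]; rewrite !mem_iota /= !add0n !ltnS; exact: le.
Qed.

(** The bounds [n <= psi g n] for [f] and for its inverse force all indices to be preserved. Links
    are then preserved with their labels, so [phi] commutes with right multiplications and is a left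
    multiplication. *)
Lemma node_aut (f k : node G -> node G) : cancel f k -> cancel k f ->
  (forall c b, adj c b -> adj (f c) (f b)) ->
  (forall c b, adj c b -> adj (k c) (k b)) -> exists g, f =1 node_act g.
Proof.
move=> fk kf fadj kadj.
have [phi [beta [psi fP]]] := node_hom_shape (can_inj fk) fadj.
have [phi' [beta' [psi' kP]]] := node_hom_shape (can_inj kf) kadj.
have psiE g n : psi g n = n.
  have [_ fL fn _] := fP g; have [_ kL kn _] := kP (phi g).
  apply/eqP; rewrite eqn_leq fn andbT; apply: leq_trans (kn _) _.
  by have := fk (Leaf g n); rewrite fL kL => -[_ ->].
have psi'E g n : psi' g n = n.
  have [_ kL kn _] := kP g; have [_ fL fn _] := fP (phi' g).
  apply/eqP; rewrite eqn_leq kn andbT; apply: leq_trans (fn _) _.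
  by have := kf (Leaf g n); rewrite kL fL => -[_ ->].
have betaE g i : beta g i = i.
  have [fC _ _ fle] := fP g; have [kC _ _ kle] := kP (phi g).
  apply/eqP; rewrite eqn_leq -{2}(psiE g i) fle//=.
  have := fk (Chain g i); rewrite fC kC => -[_ {1}<-].
  by rewrite -{2}(psi'E (phi g) (beta g i)) kle.
have link g s : f (Link g s) = Link (phi g) s /\ phi (g * s)%g = (phi g * s)%g.
  have a0 : adj (f (Link g s)) (f (Leaf g 0)) by apply: fadj; left.
  have a1 : adj (f (Link g s)) (f (Leaf (g * s)%g (enum_rank s).+1)).
    by apply: fadj; right.
  have [_ fL _ _] := fP g; have [_ fL' _ _] := fP (g * s)%g.
  move: a0 a1; rewrite fL fL' !psiE.
  case E : (f (Link g s)) => [h i|//|h s'].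
    have [kC _ _ _] := kP h.
    by have := fk (Link g s); rewrite E kC.
  move=> /= [[<- _]|[_ //]] [[_ //]|[-> [/val_inj/enum_rank_inj ->]]].
  by [].
exists (phi 1%g); have phiE g : phi g = (phi 1 * g)%g.
  by rewrite -(link 1%g g).2 mul1g.
case=> [g i|g n|g s] /=; rewrite -phiE.
- by have [-> _ _ _] := fP g; rewrite betaE.
- by have [_ -> _ _] := fP g; rewrite psiE.
- exact: (link g s).1.
Qed.


End Node.

(** * The space X *)

Lemma near_continuous (T U : topologicalType) (f : T -> U) (A : set U) u :
  continuous f -> nbhs (f u) A -> \forall v \near u, A (f v).
Proof. by move=> cf; exact: cf. Qed.

Definition model (R : realType) (G : finGroupType) (M : groupType)
  (a : group_action G M) (L : nat -> seq (R * M)) : Type :=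
  (node G + seq (R * M))%type.

Section Model.
Variables (R : realType) (G : finGroupType) (M : groupType).
Variables (a : group_action G M) (L : nat -> seq (R * M)).
Local Notation I := (unit_interval R).
Local Notation E := (step R M).
Local Notation Y := (seq (R * M)).
Local Notation X := (model a L).
Implicit Types (y : Y) (z c b : node G) (g h : G) (e : R) (n N : nat).

Definition proj_map g y : Y := [seq (tm.1, a g tm.2) | tm <- y].

Lemma gact_one g : a g 1%g = 1%g.
Proof. by apply: (@mulgI _ (a g 1%g)); rewrite -gact_morph !mulg1. Qed.

Lemma gactK g : cancel (a g) (a g^-1%g).
Proof. by move=> m; rewrite -gactM mulVg gact1. Qed.

Lemma step0_proj_map g y : step0 (proj_map g y) = step_map (a g) (step0 y).
Proof. by rewrite /step_map /= gact_one. Qed.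

Lemma step_map_act g m (x : E) :
  step_map (a g) (step_act m x) = step_act (a g m) (step_map (a g) x).
Proof.
rewrite /step_act /step_map /= gact_morph -!map_comp.
by congr pair; apply: eq_map => tm /=; rewrite gact_morph.
Qed.

Lemma near_step_gact g e (x x' : E) :
  near_step e (step_map (a g) x) (step_map (a g) x') <-> near_step e x x'.
Proof. exact: near_step_map (can_inj (gactK g)). Qed.

Lemma proj_map1 y : proj_map 1%g y = y.
Proof. by elim: y => //= -[t m] y ->; rewrite gact1. Qed.

Lemma proj_mapM g h y : proj_map (g * h)%g y = proj_map g (proj_map h y).
Proof. by elim: y => //= -[t m] y ->; rewrite gactM. Qed.

Lemma near_proj_map g e y y' :
  near_proj e y y' -> near_proj e (proj_map g y) (proj_map g y').
Proof.
move=> [m yy']; exists (a g m).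
by rewrite !step0_proj_map -step_map_act; apply/near_step_gact.
Qed.

HB.instance Definition _ := gen_eqMixin X.
HB.instance Definition _ := gen_choiceMixin X.
HB.instance Definition _ := isPointed.Build X (inr [::]).

(* The leaf [Leaf g n] is close to the point [g . L n], the more so the larger [n]. *)
Definition model_open (O : set X) :=
  (forall c b, adj c b -> O (inl c) -> O (inl b)) /\
  (forall y, O (inr y) -> exists2 e, 0 < e & exists N,
    (forall y', near_proj e y y' -> O (inr y')) /\
    (forall g n, (N <= n)%N -> near_proj e y (proj_map g (L n)) ->
       O (inl (Leaf g n)))).

Let openT : model_open setT.
Proof. by split=> // y _; exists 1 => //; exists 0%N. Qed.

Let openI : setI_closed model_open.
Proof.
move=> A B [Aa Ay] [Ba By]; split=> [c b cb [/(Aa _ _ cb) ? /(Ba _ _ cb) ?] //|y].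
move=> [/Ay[e e0 [N [Ae AN]]] /By[d d0 [K [Bd BK]]]].
exists (Num.min e d); first by rewrite lt_min e0 d0.
have le_e : Num.min e d <= e by rewrite ge_min lexx.
have le_d : Num.min e d <= d by rewrite ge_min lexx orbT.
exists (maxn N K); split=> [y' yy'|g n].
  by split; [apply/Ae/(near_proj_le le_e)|apply/Bd/(near_proj_le le_d)].
rewrite geq_max => /andP[Nn Kn] yy'.
by split; [apply/AN/(near_proj_le le_e)|apply/BK/(near_proj_le le_d)].
Qed.

Let open_bigU (T : Type) (f : T -> set X) :
  (forall i, model_open (f i)) -> model_open (\bigcup_i f i).
Proof.
move=> fo; split=> [c b cb [i _ ic]|y [i _ iy]].
  by exists i => //; apply: (fo i).1 ic.
have [e e0 [N [h k]]] := (fo i).2 y iy; exists e => //; exists N; split.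
  by move=> y' yy'; exists i => //; exact: h.
by move=> g n Nn yn; exists i => //; exact: k.
Qed.

HB.instance Definition _ := isOpenTopological.Build X openT openI open_bigU.

Lemma model_nbhs (x : X) (O : set X) : model_open O -> O x -> nbhs x O.
Proof. by move=> oO Ox; exact: open_nbhs_nbhs. Qed.

Lemma model_nbhsP (x : X) (A : set X) : nbhs x A ->
  exists O, [/\ model_open O, O x & O `<=` A].
Proof. by rewrite nbhsE => -[O [oO Ox] OA]; exists O. Qed.

(** The smallest open set containing the node [z]. *)
Definition node_nbhd z : set X :=
  [set x | x = inl z \/ exists2 b, x = inl b & adj z b].

Lemma node_nbhd_open z : model_open (node_nbhd z).
Proof.
split=> [c b + cz|y]; last by move=> [//|[]].
case: cz => [[->]|[b' [->] zb']] cb; first by right; exists b.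
by case: (adj_irr zb' cb).
Qed.

Lemma node_nbhdP (x : X) z : x = inl z -> nbhs x (node_nbhd z).
Proof. by move=> ->; apply: model_nbhs (node_nbhd_open z) _; left. Qed.

Definition proj_ball e y : set X := [set x | match x with
  | inr y' => near_proj e y y'
  | inl (Leaf g n) => near_proj e y (proj_map g (L n))
  | _ => False end].

Lemma proj_ball_open e y : model_open (proj_ball e y).
Proof.
split=> [[? ?|? ?|? ?] //|y' /near_proj_lt[d de yy']].
exists (e - d); first by rewrite subr_gt0.
by exists 0%N; split=> [y''|g n _] h; rewrite /proj_ball /= -(subrKC d e);
  exact: near_proj_trans yy' h.
Qed.

(** [Y] and all leaves but one. It is open because [model_open] constrains, near a point of [Y],
    only leaves of large index; such sets separate [Y] from each single leaf. *)
Definition avoid_leaf g n : set X := [set x | match x with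
  | inr _ => True
  | inl (Leaf h m) => ~ (h = g /\ m = n)
  | _ => False end].

Lemma avoid_leaf_open g n : model_open (avoid_leaf g n).
Proof.
split=> [[? ?|? ?|? ?] //|y' _]; exists 1 => //; exists n.+1; split=> // h m nm _ [_].
by move=> mn; move: nm; rewrite mn ltnn.
Qed.

Definition in_proj (x : X) := if x is inr _ then True else False.

Lemma in_projP (x : X) : in_proj x <-> exists y, x = inr y.
Proof. by case: x => [z|y]; split=> //; [case|exists y]. Qed.

Lemma ycont_model (T : topologicalType) (F : T -> Y) :
  continuous (fun u => inr (F u) : X) <-> ycont F.
Proof.
split=> [cF u e e0|cF u O].
  have := cF u (proj_ball e (F u)); apply; apply: model_nbhs (proj_ball_open _ _) _.
  exact: near_proj_refl.
move=> /model_nbhsP[O' [[_ oO'] O'u O'O]].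
have [e e0 [N [O'e _]]] := oO' _ O'u.
by apply: filterS (cF u e e0) => v /O'e/O'O.
Qed.

(* Paths and homotopies cannot leave [Y]: near a point of [Y] a path only meets
   leaves, and there every leaf is both open and closed. *)
Lemma path_in_proj (p : I -> X) : continuous p -> in_proj (p zero) ->
  forall t, in_proj (p t).
Proof.
move=> cp p0; apply: (unit_interval_ind p0) => t; last first.
  case E : (p t) => [z|y] pt; last by case: pt.
  by apply: filterS (near_continuous cp (node_nbhdP E)) => s [->|[b ->]].
(* The union consists of [Y] and all leaves: each leaf lies in the sets avoiding another one. *)
move=> /in_projP[y ty]; pose O : set X := \bigcup_gn (avoid_leaf gn.1 gn.2).
have oO : model_open O by apply: (@open_bigU (G * nat)%type) => gn; exact: avoid_leaf_open.
have Ot : O (p t) by rewrite ty; exists (1%g, 0%N).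
have [d d0 dO] := nbhs_ival (near_continuous cp (model_nbhs oO Ot)).
apply: filterS (near_ival t d0) => s ts; apply: contrapT => sN.
have [g [n ps]] : exists g n, p s = inl (Leaf g n).
  have := dO s ts; rewrite /=; case: (p s) sN => [z _|? []//].
  by case: z => [h i|h i|h i] [gn _] //= _; exists h, i.
(* The segment from [t] to [s] stays in the neighbourhood, so [q] meets only [Y] and leaves, where
   avoiding [Leaf g n] is a clopen condition. *)
pose q u := p (clamp (ival u * (ival s - ival t) + ival t)).
have cq : continuous q.
  apply: (@continuous_compT _ _ _ _ p) => //; apply: continuous_compT (@clamp_cts R).
  apply: continuousDr (@cst_continuous _ _ _); apply: continuousMr (@cst_continuous _ _ _).
  exact: ival_cts.
have qO u : O (q u).
  apply: dO; have u01 := ival_itv u; have s01 := ival_itv s; have t01 := ival_itv t.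
  rewrite clamp_id; last by apply/andP; split; nra.
  rewrite addrK normrM ger0_norm; last by lra.
  apply: le_lt_trans ts; rewrite ler_piMl//; lra.
suff : q one <> inl (Leaf g n) by apply; rewrite /q ival1 mul1r subrK clampK ps.
apply: (@unit_interval_ind _ (fun u => q u <> inl (Leaf g n)) zero).
- by rewrite /q ival0 mul0r add0r clampK ty.
- move=> u qu; have : avoid_leaf g n (q u).
    have [gn _ /=] := qO u.
    case: (q u) qu => [[h i|h i|h i]|] //= qu _ [hg im].
    by apply: qu; rewrite hg im.
  move=> /(model_nbhs (avoid_leaf_open g n)) /(near_continuous cq).
  by apply: filterS => v /= + E; rewrite /= E => -[].
- move=> u /contrapT /node_nbhdP /(near_continuous cq); apply: filterS.
  by move=> v /= [->|[b ->]].
Qed.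

(** [adj c b] puts [inl b] in every neighbourhood of [inl c], and continuous maps preserve this
    specialization order. *)
Lemma specialization (f : X -> X) c b (O : set X) : continuous f -> adj c b ->
  model_open O -> O (f (inl c)) -> O (f (inl b)).
Proof.
move=> cf cb oO Oc; have := cf (inl c) O (model_nbhs oO Oc).
move=> /model_nbhsP[O' [[O'a _] O'c O'O]].
by apply: O'O; exact: O'a cb O'c.
Qed.

(* Along a homotopy starting at the identity, the set of times at which a finite
   subgraph without beat points is fixed is clopen. *)
Lemma node_rigid (H : I * X -> X) : continuous H ->
  (forall z, H (zero, inl z) = inl z) -> forall t z, H (t, inl z) = inl z.
Proof.
move=> cH H0 t z; have [S nS zS] := node_no_beat_point z.
have cHt s : continuous (fun x => H (s, x)).
  apply: continuous_compT cH; apply: continuous_pair (@cst_continuous _ _ _) _.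
  by move=> x; exact: cvg_id.
have cHx x : continuous (fun s => H (s, x)).
  apply: continuous_compT cH; apply: continuous_pair _ (@cst_continuous _ _ _).
  by move=> s; exact: cvg_id.
suff P : forall s, forall w, w \in S -> H (s, inl w) = inl w by exact: P.
apply: (@unit_interval_ind _ (fun s => forall w, w \in S -> H (s, inl w) = inl w) zero).
- by move=> w _; exact: H0.
- move=> s Ps.
  have : \forall s' \near s, forall w, w \in S -> node_nbhd w (H (s', inl w)).
    have : forall w, w \in S -> \forall s' \near s, node_nbhd w (H (s', inl w)).
      by move=> w /Ps /node_nbhdP; exact: (near_continuous (cHx (inl w))).
    elim: (S) => [|w S' IH] near_S; first by apply: filterE.
    have h1 : \forall s' \near s, node_nbhd w (H (s', inl w)).
      by apply: near_S; rewrite inE eqxx.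
    have h2 : \forall s' \near s, forall w, w \in S' -> node_nbhd w (H (s', inl w)).
      by apply: IH => w' w'S; apply: near_S; rewrite inE w'S orbT.
    by apply: filterS2 h1 h2 => s' k1 k2 w'; rewrite inE => /predU1P[->|/k2].
  (* Near [s] a node can only move up. If [w] moves to the leaf [b0], all its neighbours in [S] must
     equal [b0], against the choice of [S]. *)
  apply: filterS => s' up w wS; have [//|[b0 wb0 adjb0]] := up w wS.
  have leafE b : b \in S -> adj w b -> b = b0.
    move=> bS wb; have [e|[b' _ bb']] := up b bS; last by case: (adj_irr wb bb').
    have : node_nbhd b0 (H (s', inl b)).
      by apply: specialization (cHt s') wb (node_nbhd_open b0) _; left.
    by rewrite e => -[[]|[b' [<-]] /(adj_irr adjb0)].
  have [[b [b' [bb' bS b'S wb wb']]]|[c [_ [_ _ _ cw _]]]] := nS w wS.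
    by move: bb'; rewrite (leafE b)// (leafE b')// eqxx.
  by case: (adj_irr cw adjb0).
(* If [s] is a limit of times at which [S] is fixed, every open set containing the image of [w]
   contains [w]; nodes can only have moved down, and the dual argument applies. *)
- move=> s nPs; apply: contrapT => nnear; apply: nPs.
  have near_id w O : w \in S -> model_open O -> O (H (s, inl w)) -> O (inl w).
    move=> wS oO Ow; apply: contrapT => nOw; apply: nnear.
    have := near_continuous (cHx (inl w)) (model_nbhs oO Ow).
    by apply: filterS => s' /= + Ps'; rewrite Ps'.
  have Hw w : w \in S -> H (s, inl w) = inl w \/ exists2 c, H (s, inl w) = inl c & adj c w.
    move=> wS; case E : (H (s, inl w)) => [z'|y]; last first.
      exfalso; have av g n := near_id w _ wS (avoid_leaf_open g n).
      have := av 1%g 0%N; rewrite E => /(_ Logic.I).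
      case: w wS E av => [//|g n|//] wS E av _.
      by have := av g n; rewrite E => /(_ Logic.I)[].
    have := near_id w _ wS (node_nbhd_open z'); rewrite E => /(_ (or_introl erefl)).
    by move=> [[->]|[b [->] zb]]; [left|right; exists z'].
  move=> w wS; have [//|[c0 wc0 c0w]] := Hw w wS.
  have cE c : c \in S -> adj c w -> c = c0.
    move=> cS cw; have [e|[c' _ c'c]] := Hw c cS; last by case: (adj_irr c'c cw).
    have : node_nbhd c (H (s, inl w)).
      by apply: specialization (cHt s) cw (node_nbhd_open c) _; left.
    by rewrite wc0 => -[[]//|[b [<-] cc0]]; case: (adj_irr cc0 c0w).
  have [[b [_ [_ _ _ wb _]]]|[c [c' [cc' cS c'S cw c'w]]]] := nS w wS.
    by case: (adj_irr c0w wb).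
  by move: cc'; rewrite (cE c)// (cE c')// eqxx.
Qed.

End Model.

(** * The fundamental group of X *)

Section FundamentalGroupModel.
Variables (R : realType) (G : finGroupType) (M : groupType).
Variables (a : group_action G M) (L : nat -> seq (R * M)).
Local Notation I := (unit_interval R).
Local Notation E := (step R M).
Local Notation Y := (seq (R * M)).
Local Notation X := (model a L : ptopologicalType).
Implicit Types (y : Y) (g h : G) (e : R) (m : M) (p q : loop R X).

(** Indistinguishable values may be substituted freely; this allows paths and homotopies to be given
    exact values at the ends of the contraction. *)
Lemma near_step_cont (T : topologicalType) (F F' : T -> E) : econt F ->
  (forall u e, 0 < e -> near_step e (F u) (F' u)) -> econt F'.
Proof.
move=> cF FF' u e e0; apply: filterS (cF u (e / 3) _) => [v uv|]; last by lra.
rewrite (_ : e = e / 3 + e / 3 + e / 3); last by field.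
apply: near_step_trans (near_step_trans _ uv) _; last by apply: FF'; lra.
by apply/near_step_sym/FF'; lra.
Qed.

Lemma near_proj_cont (T : topologicalType) (F F' : T -> Y) : ycont F ->
  (forall u e, 0 < e -> near_proj e (F u) (F' u)) -> ycont F'.
Proof.
move=> cF FF' u e e0; apply: filterS (cF u (e / 3) _) => [v uv|]; last by lra.
rewrite (_ : e = e / 3 + e / 3 + e / 3); last by field.
apply: near_proj_trans (near_proj_trans _ uv) _; last by apply: FF'; lra.
by apply/near_proj_sym/FF'; lra.
Qed.

Definition cut (r : R) (x : E) : E := (x.1, (r, 1%g) :: x.2).

Lemma econt_cut (T : topologicalType) (s : T -> R) (F : T -> E) :
  continuous s -> econt F -> econt (fun u => cut (s u) (F u)).
Proof.
move=> cs cF u e e0.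
have h1 : \forall v \near u, near_step (e / 2) (F u) (F v) by apply: cF; lra.
have h2 : \forall v \near u, `|s u - s v| < e / 2.
  have /cvgrPdist_lt := cs u; apply; lra.
by apply: filterS2 h1 h2 => v k1 k2; rewrite [e]splitr; exact: near_step_cons.
Qed.

Definition proj_of (x : X) : Y := if x is inr y then y else [::].

Lemma in_projE (x : X) : in_proj x -> x = inr (proj_of x).
Proof. by case: x. Qed.

Lemma loop_in_proj p t : p t = inr (proj_of (p t)).
Proof.
by apply/in_projE/path_in_proj; [exact: cts_fun|rewrite path_zero].
Qed.

Lemma ycont_proj_of (T : topologicalType) (F : T -> X) :
  continuous F -> (forall u, in_proj (F u)) -> ycont (proj_of \o F).
Proof.
move=> cF FY; apply/(ycont_model a L).
by rewrite (_ : (fun u => _) = F)//; apply/funext => u; rewrite -in_projE.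
Qed.

Lemma loop_ycont p : ycont (proj_of \o p).
Proof.
apply: ycont_proj_of => [|t]; first exact: cts_fun.
by rewrite loop_in_proj.
Qed.

(** [m] is the monodromy of [p], read off at the end of the lift that starts at the constant
    function 1. *)
Definition lifts_to p m := exists f, [/\ path_lift (proj_of \o p) f,
  f zero = step0 [::] & f one = step_act m (step0 [::])].

Lemma lifts_to_exists p : exists m, lifts_to p m.
Proof.
have [f [cf fp] f0] := path_lift_exists (@loop_ycont p).
exists (f one).1; exists f; split=> //.
  by rewrite f0 /= path_zero.
by rewrite -{1}(step_projK (f one)) fp /= path_one.
Qed.

Lemma path_lift_cst (f : I -> E) y :
  econt f -> (forall t, step_proj (f t) = y) -> forall t, f t = f zero.
Proof.
move=> cf fy; apply: path_lift_unique => //; first exact: econt_cst.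
by move=> t; rewrite !fy.
Qed.

(** When the homotopy is lifted to the square, two opposite sides lift [p] and [q], and the other
    two are constant, as lifts of constant paths. *)
Lemma lifts_to_homotopic p q m m' : homotopic_rel R [set zero; one] p q ->
  lifts_to p m -> lifts_to q m' -> m = m'.
Proof.
move=> [H [cH H0 H1 HA]] [f [[cf fp] f0 f1]] [f' [[cf' fq] f'0 f'1]].
have c1 (T U : topologicalType) (u : U) : continuous (fun t : T => (u, t)).
  by apply: continuous_pair (@cst_continuous _ _ _) _ => x; exact: cvg_id.
have c2 (T U : topologicalType) (u : U) : continuous (fun t : T => (t, u)).
  by apply: continuous_pair _ (@cst_continuous _ _ _) => x; exact: cvg_id.
have HY u : in_proj (H u).
  case: u => s t; apply: (@path_in_proj _ _ _ a L (fun s => H (s, t))).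
    exact: continuous_compT (c2 _ _ _) cH.
  by rewrite H0 loop_in_proj.
have [F [cF FH F0]] := square_lift (ycont_proj_of cH HY).
have {}F0 : F (zero, zero) = step0 [::] by rewrite F0 /= H0 path_zero.
have Ff : F (zero, one) = f one.
  apply: (@path_lift_unique _ _ (fun t => F (zero, t)) f); rewrite ?F0 ?f0//.
    exact: econt_comp (c1 _ _ _) cF.
  by move=> t; rewrite FH fp /= H0.
have Fz s : F (s, zero) = step0 [::].
  rewrite -F0; apply: (@path_lift_cst (fun s => F (s, zero)) [::]).
    exact: econt_comp (c2 _ _ _) cF.
  by move=> s'; rewrite FH /= HA ?path_zero//; left.
have Fo s : F (s, one) = F (zero, one).
  apply: (@path_lift_cst (fun s => F (s, one)) [::]).
    exact: econt_comp (c2 _ _ _) cF.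
  by move=> s'; rewrite FH /= HA ?path_one//; right.
have Ff' : F (one, one) = f' one.
  apply: (@path_lift_unique _ _ (fun t => F (one, t)) f'); rewrite ?Fz ?f'0//.
    exact: econt_comp (c1 _ _ _) cF.
  by move=> t; rewrite FH fq /= H1.
by have := Fo one; rewrite Ff Ff' f1 f'1 => -[]; rewrite !mulg1.
Qed.

(** The second half of the lift starts at a translate by [m], so it is the translate by [m] of the
    lift of [q]. *)
Lemma lifts_to_cat p q m m' :
  lifts_to p m -> lifts_to q m' -> lifts_to (loop_cat p q) (m * m')%g.
Proof.
move=> [f [[cf fp] f0 f1]] [f' [[cf' fq] f'0 f'1]].
have [F [cF FP] F0] := path_lift_exists (@loop_ycont (loop_cat p q)).
have {}F0 : F zero = step0 [::] by rewrite F0 /= path_zero.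
pose i (t : I) : I := clamp (1 / 2 * ival t + 0).
pose j (t : I) : I := clamp (1 / 2 * ival t + 1 / 2).
have iE t : ival (i t) = 1 / 2 * ival t.
  by rewrite clamp_id ?addr0//; have := ival_itv t; lra.
have jE t : ival (j t) = 1 / 2 * ival t + 1 / 2.
  by rewrite clamp_id//; have := ival_itv t; lra.
have Fi : F \o i =1 f.
  apply: path_lift_unique => //; first exact: econt_comp (@affine_cts _ _ _) cF.
    move=> t; rewrite FP fp /= loop_catl iE; last by have := ival_itv t; lra.
    by rewrite (_ : 2 * (1 / 2 * ival t) + 0 = ival t) ?clampK//; lra.
  by rewrite /= f0 -F0; congr F; apply: ival_inj; rewrite iE ival0 mulr0.
have Fj : F \o j =1 (fun t => step_act m (f' t)).
  apply: path_lift_unique => //; first exact: econt_comp (@affine_cts _ _ _) cF.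
  - exact: econt_act.
  - move=> t; rewrite step_proj_act FP fq /= loop_catr jE; last by have := ival_itv t; lra.
    by rewrite (_ : 2 * (1 / 2 * ival t + 1 / 2) + -1 = ival t) ?clampK//; lra.
  - rewrite f'0 -f1 -Fi /=; congr F; apply: ival_inj.
    by rewrite iE jE ival0 ival1 mulr0 add0r mulr1.
exists F; split=> //; rewrite step_actM -f'1 -[RHS]Fj /=; congr F.
by apply: ival_inj; rewrite jE ival1; lra.
Qed.

Lemma lifts_to_loop m : exists p, lifts_to p m.
Proof.
(* The lift sweeps a breakpoint between the values 1 and [m] from 1 down to 0; the ends are set by
   hand, being only indistinguishable from the cuts. *)
pose f (t : I) : E := if ival t == 0 then step0 [::]
  else if ival t == 1 then step_act m (step0 [::]) else cut (1 - ival t) (m, [::]).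
have cf : econt f.
  apply: (@near_step_cont _ (fun t => cut (1 - ival t) (m, [::]))).
    apply: (@econt_cut _ (fun t : I => 1 - ival t)); last exact: econt_cst.
    apply: continuousDr; first exact: cst_continuous.
    by apply: (continuous_compT (@ival_cts R)); exact: opp_continuous.
  move=> t e e0; rewrite /f; case: eqP => [->|_].
    by rewrite subr0; apply: (near_step_cut1 _ (m, [::])).
  case: eqP => [->|_]; last exact: near_step_refl.
  rewrite subrr (_ : step_act _ _ = (m, [::])); first exact: near_step_cut0.
  by rewrite /step_act /step_map /= mulg1.
have cp : continuous (fun t => inr (step_proj (f t)) : X).
  exact/ycont_model/econt_proj.
have p0 : inr (step_proj (f zero)) = point :> X.
  by rewrite /f ival0 eqxx step_proj0.
have p1 : inr (step_proj (f one)) = point :> X.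
  by rewrite /f ival1 oner_eq0 eqxx step_proj_act step_proj0.
exists (mk_path cp p0 p1); exists f; split=> //.
- by rewrite /f ival0 eqxx.
- by rewrite /f ival1 oner_eq0 eqxx.
Qed.

(** The lift is a closed loop at the constant function 1, which every cut leaves unchanged up to
    indistinguishability; so cutting contracts it relative to its end points. *)
Lemma lifts_to1 p : lifts_to p 1%g ->
  homotopic_rel R [set zero; one] p (loop_cst R X).
Proof.
move=> [f [[cf fp] f0 f1]].
pose F (u : I * I) : Y := step_proj (cut (ival u.1) (f u.2)).
pose F' (u : I * I) : Y := if ival u.1 == 0 then proj_of (p u.2)
  else if [|| ival u.1 == 1, u.2 == zero | u.2 == one] then [::] else F u.
have cF : ycont F.
  apply/econt_proj/(@econt_cut _ (fun u : I * I => ival u.1)).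
    exact: continuous_compT continuous_fst ival_cts.
  exact: econt_comp continuous_snd cf.
have cut_cst r e : 0 < e -> near_proj e (step_proj (cut r (step0 [::]))) [::].
  move=> e0; rewrite -[X in near_proj _ _ X](step_proj0).
  apply/near_step_proj/near_step_eq => // r' _.
  by rewrite /step_val /=; case: ifP.
have cF' : ycont F'.
  apply: near_proj_cont cF _ => -[s t] e e0; rewrite /F' /F /=.
  case: eqP => [->|_].
    by have /= <- := fp t; apply/near_step_proj/near_step_cut0.
  case: eqP => [->|_] /=.
    rewrite -[X in near_proj _ _ X](step_proj0); apply/near_step_proj.
    exact: near_step_cut1.
  case: eqP => [->|_] /=; first by rewrite f0; exact: cut_cst.
  case: eqP => [->|_] /=; first by rewrite f1 step_act1; exact: cut_cst.
  exact: near_proj_refl.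
exists (fun u => inr (F' u)); split.
- exact/ycont_model.
- by move=> t; rewrite /F' /= ival0 eqxx -loop_in_proj.
- by move=> t; rewrite /F' /= ival1 oner_eq0 eqxx.
- move=> s t t01; have pt : p t = inr [::].
    by case: t01 => ->; rewrite ?path_zero ?path_one.
  rewrite /F' /= pt; case: eqP => // _.
  by case: t01 => ->; rewrite eqxx !orbT.
Qed.

(** Multiplication by a loop of monodromy [m^-1] reduces to trivial monodromy. *)
Lemma lifts_to_inj p q m : lifts_to p m -> lifts_to q m ->
  \pi_(pi1 R X) p = \pi_(pi1 R X) q.
Proof.
have [r rm] := lifts_to_loop m^-1%g.
have H s : lifts_to s m -> (\pi_(pi1 R X) s * \pi_(pi1 R X) r = 1)%g.
  move=> sm; rewrite [LHS]pi1_mulE; apply/pi1P/lifts_to1.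
  by rewrite -(mulgV m); exact: lifts_to_cat.
by move=> /H pr /H qr; apply: (@mulIg _ (\pi_(pi1 R X) r)); rewrite pr qr.
Qed.

Lemma multiplicative_exists (K H : groupType) (f : K -> H) :
  {morph f : x y / (x * y)%g} -> exists F : {multiplicative K -> H}, F =1 f.
Proof.
move=> fM; pose F : {multiplicative K -> H} :=
  HB.pack_for {multiplicative K -> H} f (isMultiplicative.Build K H f fM).
by exists F.
Qed.

Lemma inj_surj_bijective (T U : Type) (f : T -> U) :
  injective f -> (forall u, exists t, f t = u) -> bijective f.
Proof.
move=> injf /choice[k kf]; exists k => // t; exact/injf/kf.
Qed.

Lemma pi1_model : exists psi : {multiplicative M -> pi1 R X}, bijective psi /\
  forall p m, lifts_to p m -> psi m = \pi_(pi1 R X) p.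
Proof.
have [l lm] := choice lifts_to_loop.
have lE p m : lifts_to p m -> \pi_(pi1 R X) (l m) = \pi_(pi1 R X) p.
  by move=> pm; exact: lifts_to_inj (lm m) pm.
have [|psi psiE] := @multiplicative_exists M (pi1 R X) (fun m => \pi_(pi1 R X) (l m)).
  move=> m m'; rewrite [RHS]pi1_mulE; apply: lE; exact: lifts_to_cat.
exists psi; split; last by move=> p m pm; rewrite psiE; exact: lE.
apply: inj_surj_bijective => [m m'|].
  by rewrite !psiE => /pi1P h; exact: lifts_to_homotopic h (lm m) (lm m').
elim/quotW=> p; have [m pm] := lifts_to_exists p.
by exists m; rewrite psiE; exact: lE.
Qed.

End FundamentalGroupModel.

(** * Self-equivalences of X *)

Section SelfEquivalencesModel.
Variables (R : realType) (G : finGroupType) (M : groupType).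
Variables (a : group_action G M) (L : nat -> seq (R * M)).
Hypothesis L_dense : forall y e N, 0 < e ->
  exists2 n, (N <= n)%N & near_proj e y (L n).
Local Notation I := (unit_interval R).
Local Notation E := (step R M).
Local Notation Y := (seq (R * M)).
Local Notation X := (model a L : ptopologicalType).
Implicit Types (y : Y) (g h : G) (e : R) (m : M) (x : X).

Definition model_act g x : X :=
  match x with inl z => inl (node_act g z) | inr y => inr (proj_map a g y) end.

(** Continuity holds because the leaves accumulate equivariantly: [Leaf g n] is attached near
    [proj_map a g (L n)] for every [g]. *)
Lemma model_act_cts g : continuous (model_act g).
Proof.
move=> x O /model_nbhsP[O' [[O'a O'y] O'x O'O]].
suff : nbhs x (model_act g @^-1` O') by apply: filterS => u; exact: O'O.
apply: model_nbhs => //; split=> [c b cb|y /O'y[e e0 [N [h k]]]].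
  exact/O'a/node_act_adj.
exists e => //; exists N; split=> [y' yy'|g' n nN yy'].
  exact/h/near_proj_map.
by apply: k => //; rewrite proj_mapM; exact: near_proj_map.
Qed.

Definition model_pmap g : Defs.pmap X X :=
  @PMap X X (HB.pack_for (continuousType X X) (model_act g)
    (isContinuous.Build X X (model_act g) (@model_act_cts g))) erefl.

Lemma model_actM g h x : model_act (g * h)%g x = model_act g (model_act h x).
Proof. by case: x => [z|y] /=; rewrite ?node_actM ?proj_mapM. Qed.

Lemma model_act1 x : model_act 1%g x = x.
Proof. by case: x => [z|y] /=; rewrite ?node_act1 ?proj_map1. Qed.

Lemma homotopic_eq (A : set X) (f f' : X -> X) :
  continuous f -> f =1 f' -> homotopic_rel R A f f'.
Proof. by move=> cf /funext <-; exact: homotopic_refl. Qed.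

Lemma model_pmap_hequiv g : is_hequiv R (model_pmap g).
Proof.
exists (model_pmap g^-1%g); split; apply: homotopic_eq => [|x /=].
- exact: continuous_compT (@model_act_cts _) (@model_act_cts _).
- by rewrite -model_actM mulVg model_act1.
- exact: continuous_compT (@model_act_cts _) (@model_act_cts _).
- by rewrite -model_actM mulgV model_act1.
Qed.

Definition model_class g : self_equiv R X :=
  \pi_(self_equiv R X) (SelfHequiv (model_pmap_hequiv g)).

Lemma model_classM : {morph model_class : g h / (g * h)%g}.
Proof.
move=> g h; rewrite [RHS]self_equiv_mulE; apply/self_equivP.
by apply: homotopic_eq => [|x]; [exact: model_act_cts|exact: model_actM].
Qed.

Lemma model_class_inj : injective model_class.
Proof.
move=> g h /self_equivP[H [cH H0 H1 _]].
(* Composed with the action of [g^-1], the homotopy starts at the identity on nodes and rigidity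
   applies. *)
have E1 z : model_act g^-1%g (H (one, inl z)) = inl z.
  apply: (@node_rigid R G M a L (fun u => model_act g^-1%g (H u))) => [|w].
    exact: continuous_compT cH (@model_act_cts _).
  by rewrite H0 /= -node_actM mulVg node_act1.
have := E1 (Link 1%g 1%g); rewrite H1 /= => -[].
by rewrite mulg1 => /(canRL (mulKVg _)); rewrite mulg1.
Qed.

Lemma model_path y : exists p : I -> X,
  [/\ continuous p, p zero = inr [::] & p one = inr y].
Proof.
pose p (t : I) : Y := if ival t == 0 then [::] else if ival t == 1 then y
  else step_proj (cut (1 - ival t) (step0 y)).
exists (fun t => inr (p t)); rewrite /p ival0 ival1 oner_eq0 !eqxx; split=> //.
apply/ycont_model; apply: (@near_proj_cont _ _ _ (fun t => step_proj (cut (1 - ival t) (step0 y)))).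
  apply/econt_proj/(@econt_cut _ _ _ (fun t : I => 1 - ival t)); last exact: econt_cst.
  apply: continuousDr; first exact: cst_continuous.
  by apply: (continuous_compT (@ival_cts R)); exact: opp_continuous.
move=> t e e0; rewrite /p; case: eqP => [->|_].
  rewrite subr0 -[X in near_proj _ _ X](@step_proj0 R M).
  by apply/near_step_proj/near_step_cut1.
case: eqP => [->|_]; last exact: near_proj_refl.
rewrite subrr -[X in near_proj _ _ X](step_proj0 y).
by apply/near_step_proj/near_step_cut0.
Qed.

(** Any point of [Y] is joined to the base point, and the image of the path starts in [Y]. *)
Lemma pmap_in_proj (f : Defs.pmap X X) y : in_proj (f (inr y)).
Proof.
have [p [cp p0 p1]] := model_path y; rewrite -p1.
apply: (@path_in_proj _ _ _ a L (f \o p)).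
  exact: continuous_compT cp (@pmap_cts _ _ f).
by rewrite /= p0 (pmap_point f).
Qed.

Lemma homotopic_id_node (f : X -> X) z :
  homotopic_rel R [set point] f (@idfun X) -> f (inl z) = inl z.
Proof.
move=> /homotopic_sym[H [cH H0 H1 _]].
by rewrite -H1; apply: node_rigid.
Qed.

(** A node sent into [Y] could not be brought back to itself by [k], which preserves [Y]. *)
Lemma node_fun (f k : Defs.pmap X X) : homotopic_rel R [set point] (k \o f) (@idfun X) ->
  exists nf, (forall z, f (inl z) = inl (nf z)).
Proof.
move=> kf; suff /choice[nf] : forall z, exists w, f (inl z) = inl w by exists nf.
move=> z; have := homotopic_id_node z kf; rewrite /=.
case: (f (inl z)) => [w _|y kz]; first by exists w.
by have := pmap_in_proj k y; rewrite kz.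
Qed.

Lemma node_fun_adj (f : Defs.pmap X X) nf : (forall z, f (inl z) = inl (nf z)) ->
  injective nf -> forall c b, adj c b -> adj (nf c) (nf b).
Proof.
move=> fE injf c b cb; have : node_nbhd (nf c) (f (inl b)).
  by apply: specialization (@pmap_cts _ _ f) cb (node_nbhd_open a L _) _; left.
rewrite fE => -[[/injf bc]|[b' [<-]//]].
by case: (adj_irr cb (z := c)); rewrite {1}bc -{2}bc.
Qed.

Lemma indistinguishable_cts (T : topologicalType) (F F' : T -> X) : continuous F ->
  (forall u, F' u = F u \/ exists y y', [/\ F u = inr y, F' u = inr y'
    & forall e, 0 < e -> near_proj e y y']) -> continuous F'.
Proof.
move=> cF FF' u O /model_nbhsP[O' [oO' O'u O'O]].
have transfer v : O' (F v) <-> O' (F' v).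
  have [->//|[y [y' [-> -> yy']]]] := FF' v; split=> /(oO'.2 _)[e e0 [_ [h _]]].
    by apply: h; exact: yy'.
  by apply/h/near_proj_sym/yy'.
have : \forall v \near u, O' (F v).
  by apply: near_continuous cF (model_nbhs oO' _); apply/transfer.
by apply: filterS => v /transfer/O'O.
Qed.

Lemma agree_on_nodes (f : Defs.pmap X X) g : (forall z, f (inl z) = inl (node_act g z)) ->
  homotopic_rel R [set point] f (model_act g).
Proof.
move=> fg; have fgy y : exists y', f (inr y) = inr y' /\
    forall e, 0 < e -> near_proj e y' (proj_map a g y).
  have /in_projP[y' fy] := pmap_in_proj f y; exists y'; split=> // e e0.
  have e20 : 0 < e / 2 by lra.
  have b1 : proj_ball (e / 2) y' (f (inr y)) by rewrite fy; exact: near_proj_refl.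
  have n1 := near_continuous (@pmap_cts _ _ f) (model_nbhs (proj_ball_open _ _ _ _) b1).
  have b2 : proj_ball (e / 2) (proj_map a g y) (model_act g (inr y)).
    exact: near_proj_refl.
  have n2 := near_continuous (@model_act_cts g) (model_nbhs (proj_ball_open _ _ _ _) b2).
  have /model_nbhsP[O [[_ oO] Oy Of]] : \forall x \near (inr y : X),
      proj_ball (e / 2) y' (f x) /\
      proj_ball (e / 2) (proj_map a g y) (model_act g x).
    exact: filterI n1 n2.
  have [d d0 [N [_ ON]]] := oO _ Oy.
  (* This gives a leaf near [y], at which [f] and the action of [g] agree. *)
  have [n Nn yn] := L_dense y N d0.
  have Oleaf : O (inl (Leaf 1%g n)) by apply: ON => //; rewrite proj_map1.
  have [] := Of _ Oleaf; rewrite fg /= => h1 h2; rewrite [e]splitr.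
  exact: near_proj_trans h1 (near_proj_sym h2).
(* The homotopy jumps at time 1 between indistinguishable values. *)
exists (fun u => if ival u.1 == 1 then model_act g u.2 else f u.2); split.
- apply: (@indistinguishable_cts _ (f \o snd)).
    exact: continuous_compT continuous_snd (@pmap_cts _ _ f).
  move=> [t [z|y]] /=; case: ifP => _; rewrite ?fg; try by left.
  by right; have [y' [fy yy']] := fgy y; exists y', (proj_map a g y).
- by move=> x; rewrite /= ival0 eq_sym oner_eq0.
- by move=> x; rewrite /= ival1 eqxx.
- by move=> t x -> /=; rewrite (pmap_point f); case: ifP.
Qed.

Lemma model_class_surj c : exists g, model_class g = c.
Proof.
elim/quotW: c => f; have [k [kf fk]] := hequiv_mapP f.
have [nf fE] := node_fun kf; have [nk kE] := node_fun fk.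
have nfK : cancel nf nk.
  by move=> z; have := homotopic_id_node z kf; rewrite /= fE kE => -[].
have nkK : cancel nk nf.
  by move=> z; have := homotopic_id_node z fk; rewrite /= kE fE => -[].
have [g gE] := node_aut nfK nkK (node_fun_adj fE (can_inj nfK))
  (node_fun_adj kE (can_inj nkK)).
exists g; apply/esym/self_equivP/agree_on_nodes => z.
by rewrite fE gE.
Qed.

(** The automorphism applied to the values of a lift gives a lift of the image loop; this makes the
    identification of [M] with [pi1] equivariant. *)
Lemma lifts_to_act (p : loop R X) m g :
  lifts_to p m -> lifts_to (pmap_loop (model_pmap g) p) (a g m).
Proof.
move=> [f [[cf fp] f0 f1]]; exists (fun t => step_map (a g) (f t)); split.
- split=> [t e e0|t].
    by apply: filterS (cf t e e0) => s; rewrite near_step_gact.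
  rewrite -{1}(step_projK (f t)) step_map_act step_proj_act -step0_proj_map step_proj0.
  by rewrite fp /= /mk_path /=; case: (p t).
- by rewrite f0 -step0_proj_map.
- by rewrite f1 step_map_act -step0_proj_map.
Qed.

End SelfEquivalencesModel.

(** * Countability of [M] and comparison of the two actions *)

Lemma group_isom_sym (K H : groupType) (f : {multiplicative K -> H}) :
  bijective f -> group_isom H K.
Proof.
move=> [k fk kf]; have [|F FE] := @multiplicative_exists H K k.
  by move=> x y; apply: (can_inj fk); rewrite gmulfM !kf.
by exists F; exists f => x; rewrite FE.
Qed.

Lemma finitely_presentable_countable (M : groupType) : finitely_presentable M ->
  exists en : nat -> M, forall m, exists k, en k = m.
Proof.
move=> [n [_ [f [f_surj _]]]].
exists (fun k => f (\pi_(free_group n) (odflt [::] (unpickle k)))) => m.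
have [w <-] := f_surj m; elim/quotW: w => w.
by exists (pickle (w : seq ('I_n * bool))); rewrite pickleK.
Qed.

Theorem theorem1 (R : realType) (G : finGroupType) (M : groupType)
    (M_fp : finitely_presentable M) (a : group_action G M) :
  exists X : ptopologicalType,
    [/\ group_isom (self_equiv R X) G,
        group_isom (pi1 R X) M
      & action_equivalent a (canonical_action R X)].
Proof.
have [en en_surj] := finitely_presentable_countable M_fp.
have [L L_dense] := step_dense R en_surj.
have [phi phiE] := multiplicative_exists (@model_classM R G M a L).
have phi_bij : bijective phi.
  apply: inj_surj_bijective => [g h|c]; first by rewrite !phiE => /model_class_inj.
  by have [g gc] := model_class_surj L_dense c; exists g; rewrite phiE.
have [psi [psi_bij psiE]] := pi1_model a L.
exists (model a L); split.
- exact: group_isom_sym phi_bij.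
- exact: group_isom_sym psi_bij.
- exists phi, psi; split=> // g m; have [p pm] := lifts_to_loop a L m.
  rewrite (psiE _ _ pm) phiE (psiE _ _ (lifts_to_act g pm)).
  by apply/esym; rewrite [LHS]self_equiv_actE; exact: pi1_mapE.
Qed.
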